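(* Let $\mathcal{L},\mathcal{L}'\subseteq\mathbb{S}^n$ be Jordan spaces of the same dimension $m$. If $\mathcal{L}$ degenerates to $\mathcal{L}'$, then $\sigma(\mathcal{L})\geq\sigma(\mathcal{L}')$, where $\sigma$ denotes the Segre symbol of a Jordan space.
   Context: $\mathbb{S}^n$ is the space of complex symmetric $n\times n$ matrices. A Jordan space $\mathcal{L}\subseteq\mathbb{S}^n$ is a linear subspace containing an invertible matrix $U$ and closed under $X\bullet_UY=\frac12(XU^{-1}Y+YU^{-1}X)$. Degeneration of Jordan spaces: if $\mathcal{L},\mathcal{L}'\subseteq\mathbb{S}^n$ are Jordan spaces of dimension $m$ with bases $X_1,\dots,X_m$ and $X_1',\dots,X_m'$, then $\mathcal{L}$ degenerates to $\mathcal{L}'$ if there exist $P\in\mathrm{GL}_n(\mathbb{C}[t^{\pm1}])$ and $Q\in\mathrm{GL}_m(\mathbb{C}[t^{\pm1}])$ such that the entries of $(Y_1,\dots,Y_m):=(PX_1P^\top,\dots,PX_mP^\top)Q$ are matrices with coefficients in $\mathbb{C}[t]$ and $X_i'=\lim_{t\to0}Y_i$ for all $i$. Segre symbol of a matrix: for an $n\times n$ complex matrix $A$ with distinct eigenvalues $\lambda_1,\dots,\lambda_\ell$ whose Jordan normal form has blocks of sizes $k^{(i)}_1\ge\dots\ge k^{(i)}_{n_i}$ for $\lambda_i$, its Segre symbol is the multiset of partitions $\{(k^{(1)}_1,\dots,k^{(1)}_{n_1}),\dots,(k^{(\ell)}_1,\dots,k^{(\ell)}_{n_\ell})\}$. Partial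 order $\ge$ on Segre symbols of $n\times n$ matrices: it is generated by $\{\tau_1,\dots,\tau_{\ell-1},\tau_\ell,\tau_{\ell+1}\}\ge\{\tau_1,\dots,\tau_{\ell-1},\tau_\ell+\tau_{\ell+1}\}$ and by $\{\tau_1,\dots,\tau_\ell,\mu\}\ge\{\tau_1,\dots,\tau_\ell,\mu'\}$ whenever $\mu$ dominates $\mu'$ in the dominance order on partitions; here the sum of partitions is entrywise (padding with zeros). Segre symbol of a Jordan space: $\sigma(\mathcal{L})$ is the maximal (with respect to $\ge$) Segre symbol of a matrix in $\mathcal{L}U^{-1}=\{XU^{-1}\mid X\in\mathcal{L}\}$, where $U\in\mathcal{L}$ is any invertible matrix; a unique maximal element exists and does not depend on $U$. *)

(* Defs.v *)
From HB Require Import structures.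
From Stdlib Require Import Relation_Operators.
From mathcomp Require Import all_boot all_order all_algebra.
From mathcomp Require Import finmap multiset fraction complex.
From mathcomp Require Import all_classical all_reals topology normedtype.

Set Implicit Arguments.
Unset Strict Implicit.
Unset Printing Implicit Defensive.

Import Order.TTheory GRing.Theory Num.Theory.
Import numFieldNormedType.Exports.

Local Open Scope mset_scope.
Local Open Scope classical_set_scope.
Local Open Scope ring_scope.

Definition is_partition (p : seq nat) : bool :=
  [&& p != [::], sorted geq p & all (fun k => 0 < k)%N p].

Definition partition_add (p q : seq nat) : seq nat :=
  mkseq (fun i => (nth 0 p i + nth 0 q i)%N) (maxn (size p) (size q)).

Definition dominates (p q : seq nat) : Prop :=
  sumn p = sumn q /\ forall k : nat, (sumn (take k q) <= sumn (take k p))%N.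

(* Both steps preserve the total sum n, so on Segre symbols of n x n matrices
   the order generated below never leaves the symbols of n x n matrices. *)
Inductive segre_step : {mset seq nat} -> {mset seq nat} -> Prop :=
| segre_step_merge (s : {mset seq nat}) (p q : seq nat) :
    is_partition p -> is_partition q ->
    segre_step (s `+` [mset p] `+` [mset q])%mset
               (s `+` [mset partition_add p q])%mset
| segre_step_dominance (s : {mset seq nat}) (p q : seq nat) :
    is_partition p -> is_partition q -> dominates p q ->
    segre_step (s `+` [mset p])%mset (s `+` [mset q])%mset.

Definition segre_ge : {mset seq nat} -> {mset seq nat} -> Prop :=
  clos_refl_trans _ segre_step.

Section Jordan.
Variable C : numClosedFieldType.

Definition jordan_block (a : C) (k : nat) : 'M[C]_k :=
  \matrix_(i < k, j < k) (a *+ (i == j) + (i.+1 == j :> nat)%:R).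

(* A block list bs records each Jordan block as (eigenvalue, size). The base
   change is rectangular because the total size of the blocks is only
   propositionally equal to n. *)
Definition has_jordan_form n (A : 'M[C]_n) (bs : seq (C * nat)) : Prop :=
  let k := fun i : 'I_(size bs) => (nth (0, 0%N) bs i).2 in
  let J := \mxdiag_(i < size bs) jordan_block (nth (0, 0%N) bs i).1 (k i) in
  all (fun b => 0 < b.2)%N bs /\
  exists (P : 'M[C]_(n, \sum_i k i)) (P' : 'M[C]_(\sum_i k i, n)),
    [/\ P *m P' = 1%:M, P' *m P = 1%:M & A = P *m J *m P'].

Definition segre_of_blocks (bs : seq (C * nat)) : {mset seq nat} :=
  seq_mset [seq sort geq [seq b.2 | b <- bs & b.1 == a]
           | a <- undup (unzip1 bs)].

Definition has_segre_symbol n (A : 'M[C]_n) (s : {mset seq nat}) : Prop :=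
  exists2 bs, has_jordan_form A bs & s = segre_of_blocks bs.

Definition is_jordan_space n (L : {vspace 'M[C]_n}) : Prop :=
  (forall X, X \in L -> X^T = X) /\
  exists U, [/\ U \in L, U \in unitmx & forall X Y, X \in L -> Y \in L ->
    2^-1 *: (X *m invmx U *m Y + Y *m invmx U *m X) \in L].

Definition segre_symbols n (L : {vspace 'M[C]_n}) (U : 'M[C]_n) :
    set {mset seq nat} :=
  [set s | exists2 X, X \in L & has_segre_symbol (X *m invmx U) s].

Definition segre_maximal (S : set {mset seq nat}) (s : {mset seq nat}) : Prop :=
  S s /\ forall s', S s' -> segre_ge s' s -> s' = s.

(* The symbol is a maximal element for some invertible U in L. Such an element
   always exists when L is a Jordan space; its uniqueness and its independence
   of U are theorems, not part of the definition. The default value mset0 is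
   only used when L contains no invertible matrix. *)
Definition jordan_segre_symbol n (L : {vspace 'M[C]_n}) : {mset seq nat} :=
  xget mset0 [set s | exists U, [/\ U \in L, U \in unitmx
                                  & segre_maximal (segre_symbols L U) s]].

(* C[t, t^-1] as a subring of C(t). *)
Definition is_laurent (f : {fraction {poly C}}) : Prop :=
  exists (p : {poly C}) (k : nat), f = tofrac p / tofrac ('X^k).

Definition laurent_mx m n (P : 'M[{fraction {poly C}}]_(m, n)) : Prop :=
  forall i j, is_laurent (P i j).

(* GL_n(C[t, t^-1]): the inverse must have Laurent polynomial entries too. *)
Definition laurent_GL n (P : 'M[{fraction {poly C}}]_n) : Prop :=
  [/\ laurent_mx P, P \in unitmx & laurent_mx (invmx P)].

Definition const_frac (c : C) : {fraction {poly C}} := tofrac c%:P.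

(* The i-th entry of the row (P X_1 P^T, ..., P X_m P^T) Q. *)
Definition degeneration_family m n (X : m.-tuple 'M[C]_n)
    (P : 'M[{fraction {poly C}}]_n) (Q : 'M[{fraction {poly C}}]_m)
    (i : 'I_m) : 'M[{fraction {poly C}}]_n :=
  \sum_(j < m) Q j i *: (P *m map_mx const_frac (tnth X j) *m P^T).

(* Changing the bases X and X' only multiplies Q on either side by constant
   invertible matrices, so the existential choice of bases is immaterial. *)
Definition degenerates m n (L L' : {vspace 'M[C]_n}) : Prop :=
  exists X X' : m.-tuple 'M[C]_n, [/\ basis_of L X, basis_of L' X' &
  exists P Q, [/\ laurent_GL P, laurent_GL Q &
  exists Y : 'I_m -> 'M[{poly C}]_n, forall i : 'I_m,
    degeneration_family X P Q i = map_mx (@tofrac _) (Y i) /\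
    map_mx (horner^~ t) (Y i) @[t --> (0 : C)^'] --> tnth X' i]].

End Jordan.

(* Main.v *)
Require Import Defs.
From Stdlib Require Import Relation_Operators.
From mathcomp Require Import all_boot all_order all_algebra.
From mathcomp Require Import closed_field.
From mathcomp Require Import multiset complex.
From mathcomp Require Import all_classical all_reals topology normedtype.
From mathcomp Require Import zify ring.

(** Write [L U^-1] for the matrices [X U^-1] with [X] in [L]. The theorem says
    that Segre symbols can only go down in a limit, and the difficulty is that
    symbols are not numbers, so that maximal has to be shown to mean greatest.

    Everything about a matrix [A] is read from the ranks of products of shifts
    [(A - l_1) ... (A - l_N)], which its Jordan blocks determine
    ([rank_shift_prod]). If the eigenvalues of [A] are collapsed by a map [phi]
    onto those of [A0], and if the rank of a product of shifts of [A] is at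
    least that of the corresponding product for [A0], then the symbol of [A] is
    at least that of [A0] ([segre_ge_of_ranks]): merging the partitions in each
    fibre of [phi] gives partitions that dominate those of [A0]. Ranks are lower
    semicontinuous, so this applies to every [A] close enough to [A0]
    ([segre_semicontinuous]).

    In a polynomial family of matrices the symbol is constant outside finitely
    many parameters ([generic_segre]): the ranks of powers of shifts by unknown
    distinct eigenvalues are expressed by a first-order formula in the
    parameter, and by quantifier elimination such a formula holds for almost all
    parameters or for almost none. On the line that joins two elements of [L],
    the generic symbol is at least both end symbols by semicontinuity, so a
    maximal symbol in [L U^-1] is the greatest one
    ([segre_maximal_greatest]). A maximal symbol exists because a weight with
    values in the natural numbers strictly increases down the order
    ([segre_ge_weight]).

    The set of symbols of [L U^-1] does not depend on the invertible [U] in [L]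
    ([segre_symbols_unit]): if [U] is a unit of the Jordan product, [V] is
    another invertible element, and [w] is a square root of [V U^-1] that is a
    polynomial in it, then conjugation by [w] carries [L U^-1] onto [L V^-1],
    because [x |-> w x w] maps the Jordan algebra [L U^-1] onto itself.

    Finally let [L] degenerate to [L'], and let [X'], [U'] be elements of [L']
    with [U'] invertible. For a small nonzero parameter, the family provides
    matrices close to [X'] and [U'] of the form [P X P^T] and [P V P^T] with [X]
    and [V] in [L], so [X V^-1] is similar to a matrix close to [X' U'^-1], and
    its symbol is at least that of [X' U'^-1] ([segre_symbols_degenerate]). *)

Set Implicit Arguments.
Unset Strict Implicit.
Unset Printing Implicit Defensive.

Import Order.TTheory GRing.Theory Num.Theory.
Import numFieldNormedType.Exports.

Local Open Scope mset_scope.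
Local Open Scope ring_scope.

(** * Ranks of products of shifts *)

Section ShiftProducts.
Variable F : fieldType.

(** The value at [A] of the monic polynomial with roots [ls]. *)
Definition shift_prod n (A : 'M[F]_n) (ls : seq F) : 'M[F]_n :=
  foldr (fun l M => (A - l%:M) *m M) 1%:M ls.

Lemma shift_prod_conj m n (A : 'M[F]_m) (B : 'M[F]_n) (P : 'M[F]_(m, n))
    (P' : 'M[F]_(n, m)) ls :
  P *m P' = 1%:M -> P' *m P = 1%:M -> A = P *m B *m P' ->
  shift_prod A ls = P *m shift_prod B ls *m P'.
Proof.
move=> PP' P'P ->; elim: ls => [|l ls IH] /=; first by rewrite mulmx1.
have -> : P *m B *m P' - l%:M = P *m (B - l%:M) *m P'.
  by rewrite mulmxBr mulmxBl mul_mx_scalar -scalemxAl PP' scalemx1.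
by rewrite IH !mulmxA -[X in X *m _ *m _]mulmxA P'P mulmx1.
Qed.

(** An entry on the [c]-th superdiagonal survives a factor [J - l] with
    [l != a] up to a nonzero constant, and moves one step up under [J - a]. *)
Lemma shift_prod_band k (B : 'M[F]_k) (a : F) ls
    (i j : 'I_k) :
  (forall i j : 'I_k, B i j = a *+ (i == j) + (i.+1 == j :> nat)%:R) ->
  ((j < i + count_mem a ls)%N -> shift_prod B ls i j = 0) /\
  ((j = i + count_mem a ls :> nat)%N -> shift_prod B ls i j != 0).
Proof.
move=> BE; elim: ls i j => [|l ls IH] i j /=.
  rewrite addn0 !mxE; split=> [lt_ji|eq_ij].
    by case: eqVneq => // eij; rewrite eij ltnn in lt_ji.
  by rewrite -val_eqE /= eq_ij eqxx oner_neq0.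
set M := shift_prod B ls in IH *; set c := count _ ls in IH *.
have -> : ((B - l%:M) *m M) i j
    = (a - l) * M i j + (\sum_(h : 'I_k | i.+1 == h :> nat) M h j).
  rewrite mxE (bigD1 i) //= !mxE BE eqxx mulr1n.
  rewrite (_ : (i.+1 == i :> nat) = false) ?addr0; last by lia.
  congr (_ + _).
  rewrite [RHS]big_mkcond /= [RHS](bigD1 i) //=.
  rewrite (_ : (i.+1 == i :> nat) = false) ?add0r; last by lia.
  apply: eq_bigr => h hi; rewrite !mxE BE [i == h]eq_sym (negPf hi).
  by rewrite subr0 add0r; case: eqP => _; rewrite ?mul1r ?mul0r.
case: (eqVneq l a) => [->|la] /=; rewrite ?subrr ?mul0r ?add0r.
  rewrite add1n; split=> hj.
    rewrite big1 // => h /eqP hi; apply: (IH h j).1. lia.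
  have hk : (i.+1 < k)%N by have := ltn_ord j; lia.
  rewrite (big_pred1 (Ordinal hk)) => [|h]; last by rewrite [RHS]eq_sym.
  by apply: (IH _ j).2 => /=; lia.
rewrite add0n; split=> hj.
  rewrite (IH i j).1 // mulr0 add0r big1 // => h /eqP hi.
  by apply: (IH h j).1; lia.
rewrite big1 ?addr0 => [|h /eqP hi]; last by apply: (IH h j).1; lia.
apply: mulf_neq0; [by rewrite subr_eq0 eq_sym | exact: (IH i j).2].
Qed.

Lemma rank_band k c (M : 'M[F]_k) :
  (forall i j : 'I_k, (j < i + c)%N -> M i j = 0) ->
  (forall i j : 'I_k, (j = i + c :> nat)%N -> M i j != 0) ->
  \rank M = (k - c)%N.
Proof.
move=> M0 M1; apply/eqP; rewrite eqn_leq; apply/andP; split.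
  pose f (i : 'I_(k - c)) : 'I_k := widen_ord (leq_subr c k) i.
  have sM : (M <= rowsub f M)%MS.
    apply/row_subP => i; case: (ltnP i (k - c)) => hi.
      rewrite (_ : row i M = row (Ordinal hi) (rowsub f M)) ?row_sub //.
      by apply/rowP => j; rewrite !mxE; congr (M _ _); apply: val_inj.
    rewrite (_ : row i M = 0) ?sub0mx //; apply/rowP => j; rewrite !mxE.
    by apply: M0; have := ltn_ord j; lia.
  by apply: leq_trans (mxrankS sM) (rank_leq_row _).
pose f (i : 'I_(k - c)) : 'I_k := widen_ord (leq_subr c k) i.
have gP (j : 'I_(k - c)) : (j + c < k)%N by have := ltn_ord j; lia.
pose g (j : 'I_(k - c)) : 'I_k := Ordinal (gP j).
have : mxsub f g M \in unitmx.
  rewrite unitmxE -det_tr det_trig; last first.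
    apply/is_trig_mxP => i j ij; rewrite !mxE; apply: M0 => /=; lia.
  rewrite rpred_prod // => i _; rewrite !mxE unitfE; exact: M1.
move/mxrank_unit => <-; rewrite mxsubcr.
apply: leq_trans (_ : \rank (rowsub f M) <= _)%N; last first.
  by rewrite rowsubE mxrankS // submxMl.
by rewrite -mxrank_tr trmx_mxsub rowsubE -[X in (_ <= X)%N]mxrank_tr mxrankS ?submxMl.
Qed.

Lemma shift_prod_mxdiag m (p_ : 'I_m -> nat) (B : forall i, 'M[F]_(p_ i)) ls :
  shift_prod (\mxdiag_i B i) ls = \mxdiag_i shift_prod (B i) ls.
Proof.
elim: ls => [|l ls IH] /=; first by rewrite mxdiagZ.
rewrite IH -mxdiagZ -mxdiagB [X in _ *m X]/mxdiag mul_mxdiag_mxblock.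
apply/eq_mxblock => i j; case: eqVneq => [->|]; last by rewrite mulmx0.
by rewrite !conform_mx_id.
Qed.

End ShiftProducts.

Section JordanRank.
Variable C : numClosedFieldType.
Implicit Types (bs : seq (C * nat)).

Lemma rank_shift_prod_block (a : C) k ls :
  \rank (shift_prod (jordan_block a k) ls) = (k - count_mem a ls)%N.
Proof.
have BE (i j : 'I_k) :
  jordan_block a k i j = a *+ (i == j) + (i.+1 == j :> nat)%:R by rewrite mxE.
by apply: rank_band => i j; case: (shift_prod_band ls i j BE).
Qed.

(** Ranks of products of shifts are the only matrix data from which Segre
    symbols are compared: unlike ranks of powers of a single [A - a], they can
    follow several eigenvalues that collide in a limit. *)
Lemma rank_shift_prod n (A : 'M[C]_n) bs ls : has_jordan_form A bs ->
  \rank (shift_prod A ls) = (\sum_(b <- bs) (b.2 - count_mem b.1 ls))%N.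
Proof.
case=> _ [P [P' [PP' P'P AE]]].
rewrite (shift_prod_conj ls PP' P'P AE) shift_prod_mxdiag.
have rP : row_full P' by apply/row_fullP; exists P.
have fP : row_free P by apply/row_freeP; exists P'; rewrite PP'.
have fP' : row_free P' by apply/row_freeP; exists P.
have rfP : row_full P by apply/row_fullP; exists P'.
rewrite mxrankMfree // -[LHS]mxrank_tr trmx_mul mxrankMfree; last first.
  by rewrite -row_leq_rank mxrank_tr col_leq_rank.
rewrite mxrank_tr rank_mxdiag [RHS](big_nth (0, 0%N)) big_mkord.
apply: eq_bigr => i _.
exact: rank_shift_prod_block.
Qed.

Lemma sum_block_sizes n (A : 'M[C]_n) bs : has_jordan_form A bs ->
  (\sum_(b <- bs) b.2)%N = n.
Proof.
move=> /(rank_shift_prod [::]); rewrite mxrank1 => ->.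
by apply: eq_bigr => b _; rewrite subn0.
Qed.

Lemma jordan_form_conj m n (A : 'M[C]_m) (B : 'M[C]_n) (P : 'M[C]_(m, n))
    (P' : 'M[C]_(n, m)) bs :
  P *m P' = 1%:M -> P' *m P = 1%:M -> A = P *m B *m P' ->
  has_jordan_form B bs -> has_jordan_form A bs.
Proof.
move=> PP' P'P AE [bs0 [Q [Q' [QQ' Q'Q BE]]]]; split=> //.
exists (P *m Q), (Q' *m P'); split.
- by rewrite !mulmxA -(mulmxA P) QQ' mulmx1.
- by rewrite !mulmxA -(mulmxA Q') P'P mulmx1.
- by rewrite AE BE !mulmxA.
Qed.

End JordanRank.

(** * Existence of Jordan forms *)

Section ShiftProductTheory.
Variable F : fieldType.
Implicit Types (ls : seq F).

Lemma shift_prod_cat n (A : 'M[F]_n) l1 l2 :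
  shift_prod A (l1 ++ l2) = shift_prod A l1 *m shift_prod A l2.
Proof. by elim: l1 => [|l l1 IH] /=; rewrite ?mul1mx // IH mulmxA. Qed.

Lemma shift_comm n (A : 'M[F]_n) a b :
  (A - a%:M) *m (A - b%:M) = (A - b%:M) *m (A - a%:M).
Proof.
rewrite !(mulmxBl, mulmxBr) !mul_scalar_mx !mul_mx_scalar !scale_scalar_mx mulrC.
by rewrite !opprB addrACA [RHS]addrACA; congr (_ + _); rewrite addrC.
Qed.

Lemma shift_prod_comm n (A : 'M[F]_n) l1 l2 :
  shift_prod A l1 *m shift_prod A l2 = shift_prod A l2 *m shift_prod A l1.
Proof.
have comm1 a ls : (A - a%:M) *m shift_prod A ls = shift_prod A ls *m (A - a%:M).
  elim: ls => [|l ls IH] /=; first by rewrite mul1mx mulmx1.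
  by rewrite mulmxA shift_comm -!mulmxA IH.
elim: l1 => [|l l1 IH] /=; first by rewrite mul1mx mulmx1.
by rewrite -mulmxA IH mulmxA comm1 mulmxA.
Qed.

Lemma shift_prod_filter n (A : 'M[F]_n) (p : pred F) ls :
  shift_prod A ls = shift_prod A (seq.filter p ls) *m shift_prod A (seq.filter (predC p) ls).
Proof.
elim: ls => [|l ls IH] /=; first by rewrite mulmx1.
rewrite IH; case: (p l) => /=; rewrite ?mulmxA //.
have -> : A - l%:M = shift_prod A [:: l] by rewrite /= mulmx1.
by rewrite (shift_prod_comm A [:: l]).
Qed.

Lemma shift_prod_eigen m n (U : 'M[F]_(m, n)) (A : 'M[F]_n) a ls :
  U *m (A - a%:M) = 0 ->
  U *m shift_prod A ls = (\prod_(l <- ls) (a - l)) *: U.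
Proof.
move=> UA; elim: ls => [|l ls IH]; first by rewrite big_nil scale1r /= mulmx1.
rewrite big_cons /= mulmxA.
have -> : U *m (A - l%:M) = (a - l) *: U.
  have -> : A - l%:M = (A - a%:M) + (a - l)%:M.
    by rewrite raddfB /= addrA subrK.
  by rewrite mulmxDr UA add0r mul_mx_scalar.
by rewrite -scalemxAl IH scalerA.
Qed.

End ShiftProductTheory.

Section JordanExistence.
Variable C : numClosedFieldType.

(** For [c = (a, k, v)], the rows [v], [v (A - a)], ..., [v (A - a)^(k-1)]: in
    the row basis that they form, a chain killed by [(A - a)^k] is a Jordan
    block. *)
Definition jordan_chain n (A : 'M[C]_n) (c : C * nat * 'rV[C]_n) :
    'M[C]_(c.1.2, n) :=
  \matrix_(j < c.1.2) (c.2 *m shift_prod A (nseq j c.1.1)).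

(** The spanning condition is a universal property, so that chains can be
    collected one by one without ever forming their span; with the condition on
    the sizes it makes the rows of all chains a basis. *)
Lemma jordan_form_of_chains n (A : 'M[C]_n) (cs : seq (C * nat * 'rV[C]_n)) :
  {in cs, forall c, (0 < c.1.2)%N} ->
  {in cs, forall c, c.2 *m shift_prod A (nseq c.1.2 c.1.1) = 0} ->
  (\sum_(c <- cs) c.1.2)%N = n ->
  (forall S : 'M[C]_n, {in cs, forall c, (jordan_chain A c <= S)%MS} ->
     (1%:M <= S)%MS) ->
  has_jordan_form A (unzip1 cs).
Proof.
move=> cs_gt0 cs_nil cs_sum cs_span; split.
  by apply/allP => _ /mapP[c /cs_gt0 ? ->].
set bs := unzip1 cs; set k := fun i : 'I_(size bs) => (nth (0, 0%N) bs i).2.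
pose c0 : C * nat * 'rV[C]_n := (0, 0%N, 0).
have szE : size bs = size cs by rewrite size_map.
have csE (i : 'I_(size bs)) : nth c0 cs i \in cs by rewrite mem_nth // -szE.
have bsE (i : 'I_(size bs)) : nth (0, 0%N) bs i = (nth c0 cs i).1.
  by rewrite /bs (nth_map c0) // -szE.
pose B i : 'M[C]_(k i, n) := \matrix_(j < k i)
  ((nth c0 cs i).2 *m shift_prod A (nseq j (nth (0, 0%N) bs i).1)).
pose P' := \mxcol_i B i.
have sumk : (\sum_i k i)%N = n.
  by rewrite -[RHS]cs_sum (big_nth c0) -szE big_mkord; apply: eq_bigr => i _; rewrite /k bsE.
have fullP' : row_full P'.
  rewrite -sub1mx (eqmx_col B); apply: cs_span => c /(nthP c0)[h].
  rewrite -szE => lti <-; apply: submx_trans (sumsmx_sup (Ordinal lti) _ (submx_refl _)) => //.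
  rewrite genmxE; apply/row_subP => j.
  have eqk : (nth c0 cs h).1.2 = k (Ordinal lti) by rewrite /k bsE.
  apply: (eq_row_sub (cast_ord eqk j)); rewrite !rowK /=.
  by have := bsE (Ordinal lti) => /= ->.
have freeP' : row_free P' by rewrite /row_free [X in _ == X]sumk.
have JP : P' *m A = (\mxdiag_i jordan_block (nth (0, 0%N) bs i).1 (k i)) *m P'.
  rewrite mul_mxdiag_mxcol mxcol_mul; apply/eq_mxcol => i.
  apply/row_matrixP => j; rewrite row_mul rowK.
  set a := (nth (0, 0%N) bs i).1; set v := (nth c0 cs i).2.
  have -> : row j (jordan_block a (k i) *m B i) =
      a *: row j (B i) + v *m shift_prod A (nseq j.+1 a).
    rewrite row_mul.
    have -> : row j (jordan_block a (k i)) =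
        a *: delta_mx 0 j + \sum_(h : 'I_(k i) | j.+1 == h :> nat) delta_mx 0 h.
      apply/rowP => h; rewrite !mxE summxE eqxx /= eq_sym.
      rewrite mulr_natr; congr (_ + _).
      case: eqP => [jh|jh]; last first.
        rewrite big1 // => h' /eqP jh'; rewrite mxE eqxx /=.
        by case: eqP => // hh'; case: jh; rewrite jh' hh'.
      rewrite (big_pred1 h) ?mxE ?eqxx // => h'.
      by rewrite jh eq_sym.
    rewrite mulmxDl -scalemxAl -rowE; congr (_ + _).
    rewrite mulmx_suml; case: (ltnP j.+1 (k i)) => hj.
      rewrite (big_pred1 (Ordinal hj)) => [|h]; last by rewrite [RHS]eq_sym.
      by rewrite -rowE rowK.
    rewrite big_pred0 => [|h]; last by have := ltn_ord h; case: eqP => //; lia.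
    have -> : j.+1 = k i by have := ltn_ord j; lia.
    by rewrite /v /a /k bsE cs_nil.
  have -> : nseq j.+1 a = nseq j a ++ [:: a].
    by rewrite -[[:: a]]/(nseq 1 a) -nseqD addn1.
  rewrite rowK shift_prod_cat /= mulmx1 [in RHS]mulmxA mulmxBr.
  by rewrite mul_mx_scalar addrC subrK.
have [P PP'] := row_fullP fullP'.
exists P, P'; split=> //; last by rewrite -mulmxA -JP mulmxA PP' mul1mx.
by apply: (row_free_inj freeP'); rewrite -mulmxA PP' mulmx1 mul1mx.
Qed.

Lemma shift_prod_annihilator n (A : 'M[C]_n) :
  exists ls, shift_prod A ls = 0.
Proof.
case: n A => [|n] A; first by exists [::]; exact: flatmx0.
have [ls pE] := closed_field_poly_normal (char_poly A); exists ls.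
have := Cayley_Hamilton A; rewrite {1}pE (monicP (char_poly_monic A)) scale1r.
rewrite rmorph_prod /= => <-; elim: ls {pE} => [|l ls IH]; first by rewrite big_nil.
by rewrite big_cons /= IH rmorphB /= horner_mx_X horner_mx_C.
Qed.

Lemma unit_antitriangular k (H : 'M[C]_k) :
  (forall i j : 'I_k, (k <= i + j)%N -> H i j = 0) ->
  (forall i j : 'I_k, (i + j).+1 = k -> H i j != 0) -> H \in unitmx.
Proof.
move=> H0 H1; rewrite -row_free_unit -row_leq_rank.
have rU : rowsub (@rev_ord k) H \in unitmx.
  rewrite unitmxE det_trig; last first.
    apply/is_trig_mxP => i j ij; rewrite !mxE; apply: H0 => /=.
    by have := ltn_ord i; lia.
  rewrite rpred_prod // => i _; rewrite !mxE unitfE; apply: H1 => /=.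
  by have := ltn_ord i; lia.
by rewrite -{1}(mxrank_unit rU) rowsubE mxrankS ?submxMl.
Qed.

(** The induction step splits off from the invariant subspace [W] a chain [V]
    of maximal length for an eigenvalue [a]: if [Phi] collects the images under
    powers of [A - a] of a column on which the last vector of the chain does not
    vanish, then [V *m Phi] is anti-triangular, so that the kernel of [Phi] in
    [W] is an invariant complement of [V]. *)
Lemma jordan_chains_exist n (A W : 'M[C]_n) : (W *m A <= W)%MS ->
  exists cs : seq (C * nat * 'rV[C]_n),
  [/\ {in cs, forall c, (0 < c.1.2)%N},
      {in cs, forall c, c.2 *m shift_prod A (nseq c.1.2 c.1.1) = 0},
      (\sum_(c <- cs) c.1.2)%N = \rank W &
      forall S : 'M[C]_n, {in cs, forall c, (jordan_chain A c <= S)%MS} ->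
        (W <= S)%MS].
Proof.
have [r] := ubnP (\rank W); elim: r W => // r IH W lerW WA.
have [->|Wn0] := eqVneq W 0.
  by exists [::]; split=> // [|S _]; rewrite ?big_nil ?mxrank0 ?sub0mx.
(* A shortest list of roots [ls] annihilating [W]: its multiplicity [k + 1] at
   [a] is the maximal length of a chain for [a]. *)
pose kills s := exists2 ls, size ls = s & W *m shift_prod A ls = 0.
have exk : exists s, `[< kills s >].
  have [ls lsE] := shift_prod_annihilator A.
  by exists (size ls); apply/asboolP; exists ls => //; rewrite lsE mulmx0.
have [_ /asboolP[ls <- Wls] lsmin] := find_ex_minn exk.
have {lsmin exk kills} lsmin l' : (size l' < size ls)%N -> W *m shift_prod A l' != 0.
  move=> lt; apply/eqP => W0; have := lsmin (size l').
  by rewrite leqNgt lt => /(_ (introT (asboolP _) _)) H; apply: notF; apply: H; exists l'.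
have [a als] : exists a, a \in ls.
  case: ls Wls {lsmin} => [|a ls _]; last by exists a; rewrite mem_head.
  by rewrite /= mulmx1 => W0; rewrite W0 eqxx in Wn0.
pose k := (count_mem a ls).-1; pose q := seq.filter (predC (pred1 a)) ls.
have kE : count_mem a ls = k.+1.
  by rewrite prednK // -has_count has_pred1.
have nseqSr m : nseq m.+1 a = nseq m a ++ [:: a].
  by rewrite -[[:: a]]/(nseq 1 a) -nseqD addn1.
have WE : W *m shift_prod A (nseq k.+1 a) *m shift_prod A q = 0.
  rewrite -mulmxA -kE -size_filter -(all_pred1P _ _ (filter_all _ _)).
  by rewrite -shift_prod_filter.
have szls : size ls = (k.+1 + size q)%N.
  by rewrite -kE -(count_predC (pred1 a) ls) size_filter.
pose U := W *m shift_prod A (q ++ nseq k a).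
have U0 : U != 0 by apply: lsmin; rewrite size_cat size_nseq szls addnC.
have UA : U *m (A - a%:M) = 0.
  rewrite -[RHS]WE -mulmxA [in RHS]shift_prod_comm nseqSr /U !shift_prod_cat /=.
  by rewrite mulmx1 !mulmxA.
(* [U] consists of eigenvectors for [a], on which the factors in [q] act by
   nonzero scalars. *)
have /matrix0Pn[i [j Mij]] : U *m shift_prod A q != 0.
  rewrite (shift_prod_eigen _ UA) scaler_eq0 (negPf U0) orbF prodf_seq_neq0.
  apply/allP => l; rewrite mem_filter /= => /andP[la _].
  by rewrite subr_eq0 eq_sym.
(* Both [v] and [phi] carry the factor [q], which makes [v] generate a chain
   for [a] and the kernel of [Phi] invariant. *)
pose v := row i (W *m shift_prod A q).
pose phi := col j (shift_prod A q).
have shiftW m (S : 'M[C]_(m, n)) s : (S <= W)%MS -> (S *m shift_prod A s <= W)%MS.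
  elim: s S => [|l s IHs] S SW /=; first by rewrite mulmx1.
  rewrite mulmxA IHs // mulmxBr mul_mx_scalar addmx_sub ?eqmx_opp ?scalemx_sub //.
  by rewrite (submx_trans _ WA) // submxMr.
have vW : (v <= W)%MS by apply: submx_trans (row_sub _ _) (shiftW _ _ _ (submx_refl _)).
have Wk s : (k < s)%N -> W *m (shift_prod A (nseq s a) *m shift_prod A q) = 0.
  move=> ks; rewrite -(subnKC ks) nseqD shift_prod_cat -mulmxA.
  move: (nseq k.+1 a) WE => T WE.
  by rewrite (shift_prod_comm A (nseq (s - k.+1) a)) !mulmxA WE mul0mx.
have vk s : (k < s)%N -> v *m shift_prod A (nseq s a) = 0.
  by move=> ks; rewrite -row_mul -mulmxA shift_prod_comm Wk ?row0.
pose c : C * nat * 'rV[C]_n := (a, k.+1, v).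
pose V : 'M[C]_(k.+1, n) := jordan_chain A c.
pose Phi : 'M[C]_(n, k.+1) := \matrix_(i < n, m < k.+1)
  (shift_prod A (nseq m a) *m phi) i 0.
have colPhi m : col m Phi = shift_prod A (nseq m a) *m phi.
  by apply/colP => i'; rewrite !mxE.
have VW : (V <= W)%MS by apply/row_subP => m; rewrite rowK /= shiftW.
have VPhiE (m1 m2 : 'I_k.+1) :
    (V *m Phi) m1 m2 = (v *m shift_prod A (nseq (m1 + m2) a) *m phi) 0 0.
  have -> : (V *m Phi) m1 m2 = (row m1 V *m col m2 Phi) 0 0.
    by rewrite !mxE; apply: eq_bigr => h _; rewrite !mxE.
  by rewrite rowK colPhi /= nseqD shift_prod_cat !mulmxA.
have uH : V *m Phi \in unitmx.
  apply: unit_antitriangular => m1 m2 m12; rewrite VPhiE.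
    by rewrite vk // mul0mx mxE.
  case: m12 => ->; apply: contraNneq Mij => H0; rewrite -H0.
  rewrite /v /phi -row_mul -mulmxA -shift_prod_cat -/U.
  by rewrite !mxE; apply/eqP; apply: eq_bigr => h _; rewrite !mxE.
pose W' := (W :&: kermx Phi)%MS.
have W'A : (W' *m A <= W')%MS.
  rewrite sub_capmx (submx_trans (submxMr _ (capmxSl _ _)) WA) /=.
  apply/sub_kermxP; apply/matrixP => i' m; rewrite [RHS]mxE.
  have -> : (W' *m A *m Phi) i' m = (row i' (W' *m A *m col m Phi)) 0 0.
    by rewrite !mxE; apply: eq_bigr => h _; rewrite !mxE.
  have kill h : W' *m (shift_prod A (nseq h a) *m phi) = 0.
    case: (ltnP k h) => hk.
      have /submxP[D ->] : (W' <= W)%MS by exact: capmxSl.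
      by rewrite -mulmxA /phi colE [X in W *m X]mulmxA [X in _ *m X]mulmxA Wk // mul0mx mulmx0.
    have /sub_kermxP W'Phi : (W' <= kermx Phi)%MS by exact: capmxSr.
    have := colPhi (Ordinal (hk : (h < k.+1)%N)) => /= <-.
    by rewrite colE mulmxA W'Phi mul0mx.
  suff -> : W' *m A *m col m Phi = 0 by rewrite row0 mxE.
  have -> : W' *m A = W' *m (A - a%:M) + a *: W'.
    by rewrite mulmxBr mul_mx_scalar subrK.
  rewrite colPhi mulmxDl -scalemxAl kill scaler0 addr0 -mulmxA [X in _ *m X]mulmxA.
  exact: (kill m.+1).
have rkWPhi : \rank (W *m Phi) = k.+1.
  apply/eqP; rewrite eqn_leq rank_leq_col /=.
  by rewrite -{1}(mxrank_unit uH) mxrankS // submxMr.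
have rkW : \rank W = (k.+1 + \rank W')%N by rewrite -rkWPhi mxrank_mul_ker.
have [||cs [cs_gt0 cs_nil cs_sum cs_span]] := IH W' => //.
  by move: lerW; rewrite rkW; lia.
exists (c :: cs); split=> [c'|c'||S cS].
- by rewrite inE => /predU1P[->|/cs_gt0].
- rewrite inE => /predU1P[->|/cs_nil //]; exact: vk.
- by rewrite big_cons cs_sum rkW.
have VS : (V <= S)%MS by move: (cS c); rewrite mem_head; apply.
have W'S : (W' <= S)%MS by apply: cs_span => c' c'cs; apply: cS; rewrite inE c'cs orbT.
(* The projection of [W] onto the chain along the kernel of [Phi]. *)
pose D := W *m Phi *m invmx (V *m Phi).
have DW : (W - D *m V <= W')%MS.
  rewrite sub_capmx addmx_sub ?eqmx_opp //=; last first.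
    by apply: submx_trans VW; apply: submxMl.
  by apply/sub_kermxP; rewrite mulmxBl -mulmxA mulmxKV // subrr.
rewrite -[W](subrK (D *m V)) addmx_sub ?(submx_trans DW) //.
by apply: submx_trans VS; apply: submxMl.
Qed.

Theorem jordan_form_exists n (A : 'M[C]_n) : exists bs, has_jordan_form A bs.
Proof.
have [|cs [cs_gt0 cs_nil cs_sum cs_span]] := @jordan_chains_exist n A 1%:M.
  exact: submx1.
by exists (unzip1 cs); apply: jordan_form_of_chains; rewrite ?cs_sum ?mxrank1.
Qed.

End JordanExistence.

(** * Segre symbols of block lists *)

Section Partitions.
Local Open Scope nat_scope.
Implicit Types (p q : seq nat).

Lemma nth_partition_add p q i :
  nth 0 (partition_add p q) i = nth 0 p i + nth 0 q i.
Proof.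
have [lti|lei] := ltnP i (maxn (size p) (size q)).
  by rewrite nth_mkseq.
rewrite !nth_default ?size_mkseq //; move: lei; rewrite geq_max; lia.
Qed.

Lemma partition_add0 p : partition_add p [::] = p.
Proof.
rewrite -[RHS](mkseq_nth 0) /partition_add maxn0.
by apply: eq_mkseq => i; rewrite nth_nil addn0.
Qed.

Lemma nth_foldr_partition_add (ps : seq (seq nat)) i :
  nth 0 (foldr partition_add [::] ps) i = \sum_(p <- ps) nth 0 p i.
Proof.
elim: ps => [|p ps IH] /=; first by rewrite nth_nil big_nil.
by rewrite nth_partition_add big_cons IH.
Qed.

Lemma sumn_take p k : sumn (take k p) = \sum_(i < k) nth 0 p i.
Proof.
elim: p k => [|x p IH] [|k] /=; rewrite ?big_ord0 //.
  by rewrite big1 // => i _; rewrite nth_nil.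
by rewrite big_ord_recl /= IH.
Qed.

Lemma partition_nth_anti p : is_partition p ->
  forall i j, i <= j -> nth 0 p j <= nth 0 p i.
Proof.
case/and3P=> _ sp _ i j leij; have [ltj|?] := ltnP j (size p); last first.
  by rewrite nth_default.
by have /(_ 0 i j) := sorted_leq_nth (rev_trans leq_trans) leqnn _ sp;
  apply; rewrite ?inE //; apply: leq_ltn_trans ltj.
Qed.

Lemma partition_nth_gt0 p i : is_partition p -> (0 < nth 0 p i) = (i < size p).
Proof.
case/and3P=> _ _ /allP pp; have [lti|?] := ltnP i (size p).
  by rewrite pp // mem_nth.
by rewrite nth_default.
Qed.

Lemma is_partition_add p q :
  is_partition p -> is_partition q -> is_partition (partition_add p q).
Proof.
move=> hp hq; have szE : size (partition_add p q) = maxn (size p) (size q).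
  by rewrite size_mkseq.
apply/and3P; split.
- rewrite -size_eq0 szE; by case/and3P: hp => + _ _; rewrite -size_eq0 -!lt0n leq_max => ->.
- apply/(sortedP 0) => i _; rewrite /geq /= !nth_partition_add.
  by rewrite leq_add // partition_nth_anti.
- apply/(all_nthP 0) => i; rewrite szE nth_partition_add leq_max addn_gt0.
  by rewrite !partition_nth_gt0.
Qed.

Lemma is_partition_foldr_add (ps : seq (seq nat)) :
  ps != [::] -> all is_partition ps -> is_partition (foldr partition_add [::] ps).
Proof.
case: ps => // p ps _ /= /andP[]; elim: ps p => [|q ps IH] p /= hp.
  by rewrite partition_add0.
by case/andP=> hq hps; apply: is_partition_add; last exact: IH.
Qed.

End Partitions.

Section SegreOrder.
Local Open Scope nat_scope.
Implicit Types (s u : {mset seq nat}).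

Lemma segre_ge_trans s1 s2 s3 :
  segre_ge s1 s2 -> segre_ge s2 s3 -> segre_ge s1 s3.
Proof. exact: rt_trans. Qed.

Lemma segre_ge_msetD2l u s s' :
  segre_ge s s' -> segre_ge (u `+` s)%mset (u `+` s')%mset.
Proof.
elim=> {s s'} [s s' st|s|s1 s2 s3 _ H1 _ H2].
- apply: rt_step; case: st => s0 p q *; rewrite ?msetDA.
    exact: segre_step_merge.
  exact: segre_step_dominance.
- exact: rt_refl.
- exact: rt_trans H1 H2.
Qed.

Lemma segre_ge_msetD s s' u u' : segre_ge s s' -> segre_ge u u' ->
  segre_ge (s `+` u)%mset (s' `+` u')%mset.
Proof.
move=> ss' uu'; apply: rt_trans (segre_ge_msetD2l _ uu') _.
by rewrite ![(_ `+` u')%mset]msetDC; apply: segre_ge_msetD2l.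
Qed.

Lemma seq_mset_cat (T : choiceType) (l1 l2 : seq T) :
  seq_mset (l1 ++ l2) = (seq_mset l1 `+` seq_mset l2)%mset.
Proof. by apply/msetP => x; rewrite msetE2 !mset_seqE count_cat. Qed.

Lemma seq_mset1 (T : choiceType) (x : T) : seq_mset [:: x] = [mset x]%mset.
Proof.
by apply/msetP => y; rewrite mset_seqE msetnE /= addn0 eq_sym; case: eqP.
Qed.

Lemma segre_ge_merge (ps : seq (seq nat)) : ps != [::] -> all is_partition ps ->
  segre_ge (seq_mset ps) [mset foldr partition_add [::] ps]%mset.
Proof.
case: ps => // p ps _; elim: ps p => [|q ps IH] p /=.
  by rewrite partition_add0 seq_mset1 => _; apply: rt_refl.
case/andP=> hp hps; rewrite -cat1s seq_mset_cat seq_mset1.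
apply: rt_trans (segre_ge_msetD2l _ (IH q hps)) _; apply: rt_step.
have := @segre_step_merge mset0 p (foldr partition_add [::] (q :: ps)) hp.
by rewrite !mset0D; apply; apply: is_partition_foldr_add.
Qed.

(** Both kinds of steps of the order act inside the fibres of [phi]: the
    partitions in a fibre merge into one, which then drops to its target. *)
Lemma segre_ge_fibers (I J : eqType) (es : seq I) (fs : seq J)
    (phi : I -> J) (p : I -> seq nat) (q : J -> seq nat) :
  uniq fs -> {in es, forall i, phi i \in fs} ->
  {in es, forall i, is_partition (p i)} ->
  {in fs, forall j, is_partition (q j)} ->
  {in fs, forall j, dominates
     (foldr partition_add [::] [seq p i | i <- es & phi i == j]) (q j)} ->
  segre_ge (seq_mset [seq p i | i <- es]) (seq_mset [seq q j | j <- fs]).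
Proof.
elim: fs es => [|j fs IH] es /=.
  case: es => [|i es] _ phiP _ _ _; first exact: rt_refl.
  by have := phiP i; rewrite mem_head => /(_ isT).
case/andP=> jfs ufs phiP pP qP dom.
set fib := [seq i <- es | phi i == j]; set rest := [seq i <- es | phi i != j].
have -> : seq_mset [seq p i | i <- es] =
    (seq_mset [seq p i | i <- fib] `+` seq_mset [seq p i | i <- rest])%mset.
  rewrite -seq_mset_cat -map_cat; apply/eq_seq_msetP/perm_map.
  by rewrite perm_sym perm_filterC.
rewrite -cat1s seq_mset_cat seq_mset1; apply: segre_ge_msetD; last first.
  apply: IH => //.
  - move=> i; rewrite mem_filter => /andP[ij /phiP].
    by rewrite inE (negPf ij).
  - by move=> i; rewrite mem_filter => /andP[_ /pP].
  - by move=> j' j'fs; apply: qP; rewrite inE j'fs orbT.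
  move=> j' j'fs; rewrite /rest -filter_predI.
  rewrite (@eq_filter _ _ (fun i => phi i == j')).
    by apply: dom; rewrite inE j'fs orbT.
  move=> i /=; case: eqVneq => // ->; case: eqVneq => // jj'.
  by rewrite -jj' j'fs in jfs.
have qj := qP j (mem_head _ _); have domj := dom j (mem_head _ _).
have pfib : all is_partition [seq p i | i <- fib].
  by apply/allP => _ /mapP[i + ->]; rewrite mem_filter => /andP[_ /pP].
have fib0 : [seq p i | i <- fib] != [::].
  apply/eqP => f0; move: domj; rewrite -/fib f0 => -[/= + _].
  have := partition_nth_gt0 0 qj; by case: (q j) qj => // x r _ /= + e; case: x e.
apply: rt_trans (segre_ge_merge fib0 pfib) _; apply: rt_step.
have := @segre_step_dominance mset0 _ _ (is_partition_foldr_add fib0 pfib) qj domj.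
by rewrite !mset0D.
Qed.
End SegreOrder.

Section RankCriterion.
Local Open Scope nat_scope.
Implicit Types (p q : seq nat).

Lemma sum_nth_seq p (f : nat -> nat) K : f 0 = 0 -> size p <= K ->
  \sum_(x <- p) f x = \sum_(i < K) f (nth 0 p i).
Proof.
move=> f0 lepK; rewrite (big_nth 0) -(big_mkord xpredT (fun i => f (nth 0 p i))).
rewrite [RHS](@big_cat_nat _ _ _ (size p)) //= [X in _ = _ + X]big_nat_cond.
by rewrite [X in _ = _ + X]big1 ?addn0 // => i /andP[/andP[? _] _]; rewrite nth_default.
Qed.

Lemma sumn_partition_add p q : sumn (partition_add p q) = sumn p + sumn q.
Proof.
have sumE r : sumn r = \sum_(x <- r) x by rewrite sumnE.
rewrite !sumE !(@sum_nth_seq _ id (maxn (size p) (size q))) ?leq_maxl ?leq_maxr //.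
  by rewrite -big_split; apply: eq_bigr => i _; rewrite nth_partition_add.
by rewrite size_mkseq.
Qed.

Lemma sumn_foldr_partition_add (ps : seq (seq nat)) :
  sumn (foldr partition_add [::] ps) = \sum_(p <- ps) sumn p.
Proof.
elim: ps => [|p ps IH] /=; first by rewrite big_nil.
by rewrite sumn_partition_add big_cons IH.
Qed.

Lemma sumn_take_le q k N : sumn (take k q) <= \sum_(x <- q) (x - N) + k * N.
Proof.
elim: q k => [|x q IH] [|k] //=.
by rewrite big_cons mulSn; have := IH k; lia.
Qed.

(** Only the first [k] parts can exceed the part number [k] (counted from 0), so
    the bound [sumn_take_le] is attained when [N] is that part. *)
Lemma sumn_take_cut p k : is_partition p ->
  sumn (take k p) = \sum_(x <- p) (x - nth 0 p k) + k * nth 0 p k.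
Proof.
move=> pp; rewrite (@sum_nth_seq p (subn^~ (nth 0 p k)) (k + size p)) ?leq_addl //.
rewrite big_split_ord /= [X in _ + X + _]big1 => [|i _]; last first.
  by apply/eqP; rewrite subn_eq0 partition_nth_anti // leq_addr.
rewrite addn0 sumn_take -[k * _](_ : \sum_(i < k) nth 0 p k = _); last first.
  by rewrite sum_nat_const card_ord.
rewrite -big_split; apply: eq_bigr => i _ /=.
by rewrite subnK // partition_nth_anti // ltnW.
Qed.

Variable C : numClosedFieldType.
Implicit Types (bs : seq (C * nat)) (a : C).

Definition block_partition bs a := sort geq [seq b.2 | b <- bs & b.1 == a].

Lemma sum_block_partition bs a (F : nat -> nat) :
  \sum_(k <- block_partition bs a) F k = \sum_(b <- bs | b.1 == a) F b.2.
Proof.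
by rewrite (perm_big _ (permEl (perm_sort _ _))) big_map big_filter.
Qed.

Lemma sum_over_eigenvalues bs (P : pred C) (F : C -> nat -> nat) :
  \sum_(b <- bs | P b.1) F b.1 b.2 =
  \sum_(a <- undup (unzip1 bs) | P a) \sum_(b <- bs | b.1 == a) F a b.2.
Proof.
rewrite (exchange_big_dep (fun b => P b.1)) /= => [|a b Pa /eqP -> //].
rewrite [LHS]big_seq_cond [RHS]big_seq_cond; apply: eq_bigr => b /andP[bbs Pb].
rewrite (eq_bigl (fun a => a == b.1)) => [|a]; last first.
  by rewrite eq_sym; case: eqVneq => [->|]; rewrite ?Pb ?andbF.
by rewrite -big_filter filter_pred1_uniq ?undup_uniq ?mem_undup ?map_f // big_seq1.
Qed.

Lemma block_partitionP bs a : all (fun b => 0 < b.2) bs ->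
  a \in unzip1 bs -> is_partition (block_partition bs a).
Proof.
move=> /allP bs0 /mapP[b bbs ->]; apply/and3P; split.
- rewrite -size_eq0 size_sort -lt0n size_map size_filter -has_count.
  by apply/hasP; exists b => /=.
- by apply: sort_sorted => x y; exact: leq_total.
- rewrite all_sort; apply/allP => _ /mapP[c + ->].
  by rewrite mem_filter => /andP[_ /bs0].
Qed.

(** The hypothesis says that ranks of products of shifts can only drop when the
    eigenvalues of [bs] are collapsed along [phi] to those of [bs0]. Taking the
    multiplicities as exponents shows that multiplicities add up along the
    fibres of [phi]. To compare the sums of the [k] largest parts, take for the
    exponent of [a] the part number [k] of its partition: by [sumn_take_cut]
    this loses nothing on the side of [bs], and [sumn_take_le] bounds the side
    of [bs0]. *)
Lemma segre_ge_of_ranks bs bs0 (phi : C -> C) n :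
  all (fun b => 0 < b.2) bs -> all (fun b => 0 < b.2) bs0 ->
  \sum_(b <- bs) b.2 = n -> \sum_(b <- bs0) b.2 = n ->
  {in unzip1 bs, forall a, phi a \in unzip1 bs0} ->
  (forall mu (e : C -> nat), mu \in unzip1 bs0 ->
    let N := \sum_(a <- undup (unzip1 bs) | phi a == mu) e a in N <= n ->
    \sum_(b <- bs0) (b.2 - (b.1 == mu) * N) <=
    \sum_(b <- bs) (b.2 - (phi b.1 == mu) * e b.1)) ->
  segre_ge (segre_of_blocks bs) (segre_of_blocks bs0).
Proof.
move=> bs_gt0 bs0_gt0 bsn bs0n phiP rk.
pose mult a := \sum_(b <- bs | b.1 == a) b.2.
pose fib mu := \sum_(b <- bs | phi b.1 == mu) b.2.
pose mult0 mu := \sum_(b <- bs0 | b.1 == mu) b.2.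
have fibE mu : fib mu = \sum_(a <- undup (unzip1 bs) | phi a == mu) mult a.
  exact: (sum_over_eigenvalues _ (fun a => phi a == mu) (fun _ k => k)).
have fib_le mu : fib mu <= n by rewrite -bsn [leqRHS](bigID (fun b => phi b.1 == mu)) leq_addr.
have split0 mu N : \sum_(b <- bs0) (b.2 - (b.1 == mu) * N) + mult0 mu =
    n + \sum_(b <- bs0 | b.1 == mu) (b.2 - N).
  rewrite -bs0n (bigID (fun b => b.1 == mu)) [in RHS](bigID (fun b => b.1 == mu)) /=.
  rewrite -/(mult0 mu) addnC addnA addnAC; congr (_ + _ + _).
    by apply: eq_bigr => b /negPf ->; rewrite mul0n subn0.
  by apply: eq_bigr => b ->; rewrite mul1n.
have split1 mu e : \sum_(b <- bs) (b.2 - (phi b.1 == mu) * e b.1) + fib mu =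
    n + \sum_(b <- bs | phi b.1 == mu) (b.2 - e b.1).
  rewrite -bsn (bigID (fun b => phi b.1 == mu)) [in RHS](bigID (fun b => phi b.1 == mu)) /=.
  rewrite -/(fib mu) addnC addnA addnAC; congr (_ + _ + _).
    by apply: eq_bigr => b /negPf ->; rewrite mul0n subn0.
  by apply: eq_bigr => b ->; rewrite mul1n.
have le_mult b : b \in bs -> b.2 <= mult b.1.
  by move=> bbs; rewrite /mult (big_rem b) //= eqxx leq_addr.
have fib_le0 mu : mu \in unzip1 bs0 -> fib mu <= mult0 mu.
  move=> mu0; have := rk mu mult mu0; rewrite /= -fibE => /(_ (fib_le mu)).
  have := split1 mu mult; have := split0 mu (fib mu).
  have -> : \sum_(b <- bs | phi b.1 == mu) (b.2 - mult b.1) = 0.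
    by rewrite big_seq_cond big1 // => b /andP[/le_mult + _]; rewrite -subn_eq0 => /eqP.
  by move: (bigop _ _ _) (bigop _ _ _) (bigop _ _ _) => x y z; lia.
have fib_eq mu : mu \in unzip1 bs0 -> fib mu = mult0 mu.
  move=> mu0; apply/eqP; rewrite eqn_leq fib_le0 //=.
  have total : \sum_(nu <- undup (unzip1 bs0)) fib nu =
      \sum_(nu <- undup (unzip1 bs0)) mult0 nu.
    rewrite -[RHS](sum_over_eigenvalues _ xpredT (fun _ k => k)) bs0n -bsn.
    rewrite /fib (exchange_big_dep xpredT) //= [RHS]big_seq [LHS]big_seq.
    apply: eq_bigr => b bbs.
    rewrite (eq_bigl (fun a => a == phi b.1)) => [|a]; last by rewrite eq_sym.
    rewrite -big_filter filter_pred1_uniq ?undup_uniq ?mem_undup ?big_seq1 //.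
    by apply: phiP; apply: map_f.
  have mu0' : mu \in undup (unzip1 bs0) by rewrite mem_undup.
  move: total; rewrite (big_rem mu) //= [RHS](big_rem mu) //= => total.
  have : \sum_(nu <- rem mu (undup (unzip1 bs0))) fib nu <=
         \sum_(nu <- rem mu (undup (unzip1 bs0))) mult0 nu.
    rewrite big_seq [leqRHS]big_seq; apply: leq_sum => nu /mem_rem.
    by rewrite mem_undup => /fib_le0.
  move=> le; rewrite -(leq_add2r (\sum_(nu <- rem mu (undup (unzip1 bs0))) mult0 nu)).
  by rewrite -total leq_add2l.
apply: (@segre_ge_fibers _ _ _ _ phi) => [|a|a|a|mu].
- exact: undup_uniq.
- by rewrite !mem_undup => /phiP.
- by rewrite mem_undup => /(block_partitionP bs_gt0).
- by rewrite mem_undup => /(block_partitionP bs0_gt0).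
rewrite mem_undup => mu0; split=> [|k].
  rewrite sumn_foldr_partition_add big_map big_filter [sumn (block_partition _ _)]sumnE.
  rewrite sum_block_partition -/(mult0 mu) -fib_eq // fibE; apply: eq_bigr => a _.
  by rewrite sumnE sum_block_partition.
rewrite [leqRHS]sumn_take.
under eq_bigr => i _ do rewrite nth_foldr_partition_add.
rewrite exchange_big /= big_map big_filter big_seq_cond.
pose e a := nth 0 (block_partition bs a) k.
pose N := \sum_(a <- undup (unzip1 bs) | phi a == mu) e a.
rewrite (eq_bigr (fun a => \sum_(x <- block_partition bs a) (x - e a) + k * e a)); last first.
  move=> a /andP[ain _]; rewrite -sumn_take sumn_take_cut //.
  by apply: block_partitionP => //; rewrite -mem_undup.
rewrite -big_seq_cond big_split /= -big_distrr /= -/N.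
apply: leq_trans (sumn_take_le _ k N) _; rewrite leq_add2r sum_block_partition.
rewrite (eq_bigr _ (fun a _ => sum_block_partition bs a (subn^~ (e a)))).
rewrite -(sum_over_eigenvalues _ (fun a => phi a == mu) (fun a x => x - e a)).
have N_le : N <= n.
  apply: leq_trans (fib_le mu); rewrite fibE; apply: leq_sum => a _.
  rewrite /mult -(sum_block_partition _ _ id) /= /e.
  have [ltk|?] := ltnP k (size (block_partition bs a)); last by rewrite nth_default.
  by rewrite (big_nth 0) (big_mkord) (bigD1 (Ordinal ltk)) //= leq_addr.
rewrite -(leq_add2l n) -(split0 mu N) -(split1 mu e) fib_eq // leq_add2r.
exact: (rk mu e mu0 N_le).
Qed.
End RankCriterion.

(** * Segre symbols of nearby matrices *)

Section LocalSemicontinuity.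
Variable C : numClosedFieldType.

Definition mx_close (d : C) m n (A B : 'M[C]_(m, n)) :=
  forall i j, `|A i j - B i j| < d.

Lemma mx_close_le d d' m n (A B : 'M[C]_(m, n)) :
  d <= d' -> mx_close d A B -> mx_close d' A B.
Proof. by move=> dd' AB i j; apply: lt_le_trans dd'. Qed.

Lemma exists_le2 (d1 d2 : C) : 0 < d1 -> 0 < d2 ->
  exists2 d : C, 0 < d & d <= d1 /\ d <= d2.
Proof.
move=> h1 h2; have /orP[h|h] := real_leVge (gtr0_real h1) (gtr0_real h2).
  by exists d1.
by exists d2.
Qed.

Lemma exists_pos_all (T : eqType) (s : seq T) (P : T -> C -> Prop) :
  (forall x d d', d' <= d -> P x d -> P x d') ->
  {in s, forall x, exists2 d : C, 0 < d & P x d} ->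
  exists2 d : C, 0 < d & {in s, forall x, P x d}.
Proof.
move=> Pmon; elim: s => [|x s IH] Ps; first by exists 1.
have [|d1 d1_gt0 P1] := IH; first by move=> y ys; apply: Ps; rewrite inE ys orbT.
have [d2 d2_gt0 P2] := Ps x (mem_head _ _).
have [d d_gt0 [dd1 dd2]] := exists_le2 d1_gt0 d2_gt0; exists d => // y.
by rewrite inE => /predU1P[->|/P1]; [apply: Pmon P2 | apply: Pmon].
Qed.

Lemma mulmx_close m n p (A0 : 'M[C]_(m, n)) (B0 : 'M[C]_(n, p)) (eps : C) : 0 < eps ->
  exists2 d : C, 0 < d & forall A B, mx_close d A A0 -> mx_close d B B0 ->
    mx_close eps (A *m B) (A0 *m B0).
Proof.
move=> eps_gt0.
have le_sum a b (X : 'M[C]_(a, b)) i j : `|X i j| <= \sum_i \sum_j `|X i j|.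
  rewrite (bigD1 i) //= ler_wpDr ?sumr_ge0 // => [*|]; first exact: sumr_ge0.
  by rewrite (bigD1 j) //= ler_wpDr ?sumr_ge0.
pose M : C := (\sum_i \sum_j `|A0 i j|) + \sum_i \sum_j `|B0 i j|.
have A0M i j : `|A0 i j| <= M.
  by apply: ler_wpDr (le_sum _ _ _ _ _); rewrite !sumr_ge0 // => *; rewrite ?sumr_ge0.
have B0M i j : `|B0 i j| <= M.
  by apply: ler_wpDl (le_sum _ _ _ _ _); rewrite !sumr_ge0 // => *; rewrite ?sumr_ge0.
have M0 : 0 <= M by apply: addr_ge0; apply: sumr_ge0 => ? _; apply: sumr_ge0.
pose K : C := n%:R * (1 + M + M).
have K0 : 0 <= K by apply: mulr_ge0 => //; apply: addr_ge0 => //; apply: addr_ge0.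
have eK : 0 < eps + K by rewrite ltr_wpDr.
pose d := eps / (eps + K).
have d_gt0 : 0 < d by rewrite divr_gt0.
have d_le1 : d <= 1 by rewrite ler_pdivrMr // mul1r lerDl.
have dK : d * K < eps by rewrite /d mulrAC ltr_pdivrMr // ltr_pM2l // ltrDr.
exists d => // A B hA hB i j; apply: le_lt_trans dK.
rewrite !mxE -sumrB; apply: le_trans (ler_norm_sum _ _ _) _.
apply: le_trans (_ : \sum_(k < n) (d * (1 + M + M)) <= _); last first.
  by rewrite sumr_const card_ord -mulr_natl mulrCA.
apply: ler_sum => k _.
have -> : A i k * B k j - A0 i k * B0 k j =
  (A i k - A0 i k) * (B k j - B0 k j) + (A i k - A0 i k) * B0 k j
  + A0 i k * (B k j - B0 k j) by ring.
have -> : d * (1 + M + M) = d + d * M + d * M by ring.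
apply: le_trans (ler_normD _ _) _; apply: lerD.
  apply: le_trans (ler_normD _ _) _; apply: lerD; rewrite normrM.
    rewrite -[leRHS]mulr1; apply: ler_pM => //; first exact: ltW.
    by apply: le_trans d_le1; exact: ltW.
  by apply: ler_pM => //; exact: ltW.
by rewrite normrM mulrC; apply: ler_pM => //; exact: ltW.
Qed.

Lemma shift_prod_close n (A0 : 'M[C]_n) (ls0 : seq C) (eps : C) : 0 < eps ->
  exists2 d : C, 0 < d & forall A ls, mx_close d A A0 ->
    all2 (fun l l0 => `|l - l0| < d) ls ls0 ->
    mx_close eps (shift_prod A ls) (shift_prod A0 ls0).
Proof.
elim: ls0 eps => [|l0 ls0 IH] eps eps_gt0.
  by exists 1 => // A [|//] _ _ i j; rewrite subrr normr0.
have [d1 d1_gt0 H1] := mulmx_close (A0 - l0%:M) (shift_prod A0 ls0) eps_gt0.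
have [d2 d2_gt0 H2] := IH _ d1_gt0.
have d12_gt0 : 0 < d1 / 2 by rewrite divr_gt0.
have [d d_gt0 [dd1 dd2]] := exists_le2 d12_gt0 d2_gt0.
exists d => // A [//|l ls] AA0 /= /andP[ll0 lsls0].
apply: H1 => [i j|].
  rewrite !mxE (_ : _ - _ = (A i j - A0 i j) - (l - l0) *+ (i == j)); last first.
    by rewrite mulrnBl; ring.
  apply: le_lt_trans (ler_normB _ _) _; rewrite [ltRHS](splitr d1).
  apply: ltrD; first exact: lt_le_trans (AA0 i j) dd1.
  by case: (i == j); rewrite ?mulr1n ?mulr0n ?normr0 //; apply: lt_le_trans dd1.
apply: H2 (mx_close_le dd2 AA0) _.
elim: ls ls0 lsls0 {IH AA0} => [|x s IHs] [|y t] //= /andP[xy /IHs ->].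
by rewrite (lt_le_trans xy).
Qed.

(** Compare the sums of the absolute values of the coordinates of both sides.
    The bound gives the openness of invertibility, with [c = -1], and keeps the
    eigenvalues of a perturbed matrix close to the original ones. *)
Lemma row_small_entries n (v : 'rV[C]_n) (M : 'M[C]_n) (c d : C) :
  (forall i j, `|M i j| <= d) -> v *m M = c *: v -> v != 0 -> `|c| <= n%:R * d.
Proof.
move=> Md vM v0; pose S : C := \sum_j `|v 0 j|.
have S_gt0 : 0 < S.
  have [i [j vij]] := matrix0Pn _ v0.
  rewrite /S (bigD1 j) //= ltr_pwDl ?sumr_ge0 // normr_gt0.
  by rewrite (ord1 i) in vij.
rewrite -(ler_pM2r S_gt0) mulr_sumr.
apply: le_trans (_ : \sum_(j < n) (d * S) <= _); last first.
  by rewrite sumr_const card_ord -mulrA mulr_natl.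
apply: ler_sum => j _; rewrite -normrM.
have -> : c * v 0 j = (v *m M) 0 j by rewrite vM mxE.
rewrite mxE mulr_sumr; apply: le_trans (ler_norm_sum _ _ _) _.
by apply: ler_sum => k _; rewrite normrM mulrC ler_wpM2r.
Qed.

Lemma row_free_near1 n (M : 'M[C]_n) : mx_close (n.+1%:R^-1) M 1%:M -> row_free M.
Proof.
move=> M1; rewrite -kermx_eq0; apply/eqP/row_matrixP => i; rewrite row0.
apply/eqP; apply: contraT => v0; set v := row i _ in v0.
have vM : v *m M = 0 by rewrite -row_mul mulmx_ker row0.
have := @row_small_entries n v (M - 1%:M) (-1) n.+1%:R^-1.
rewrite mulmxBr vM sub0r mulmx1 scaleN1r normrN1 ler_pdivlMr ?ltr0n // mul1r ler_nat ltnn.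
by apply=> // i' j; rewrite !mxE; have := M1 i' j; rewrite !mxE => /ltW.
Qed.

(** A rank factorization turns [B0] into an identity matrix of size its rank,
    and a matrix close to the identity stays invertible. *)
Lemma rank_semicontinuous m n (B0 : 'M[C]_(m, n)) :
  exists2 d : C, 0 < d & forall B, mx_close d B B0 -> (\rank B0 <= \rank B)%N.
Proof.
have [L LB] : exists L, L *m col_base B0 = 1%:M by apply/row_fullP; exact: col_base_full.
have [R BR] : exists R, row_base B0 *m R = 1%:M by apply/row_freeP; exact: row_base_free.
have LBR : L *m B0 *m R = 1%:M.
  by rewrite -[X in L *m X](mulmx_base B0) mulmxA LB mul1mx.
have e_gt0 : 0 < (\rank B0).+1%:R^-1 :> C by rewrite invr_gt0 ltr0n.
have [d1 d1_gt0 H1] := mulmx_close (L *m B0) R e_gt0.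
have [d2 d2_gt0 H2] := mulmx_close L B0 d1_gt0.
exists d2 => // B BB0; have cc (d : C) p q (X : 'M[C]_(p, q)) : 0 < d -> mx_close d X X.
  by move=> d0 i j; rewrite subrr normr0.
have : row_free (L *m B *m R).
  apply: row_free_near1; rewrite -LBR.
  by apply: H1; [apply: H2 => //; exact: cc | exact: cc].
rewrite /row_free => /eqP rE; rewrite -{1}rE.
by apply: leq_trans (mxrankM_maxl _ _) _; exact: mxrankM_maxr.
Qed.

(** Each eigenvalue of a matrix [A] near [A0] is near an eigenvalue of [A0],
    which defines [phi]. A product of [N] shifts of [A] by eigenvalues near [mu]
    is then near [(A0 - mu)^N], so its rank is at least that of the latter, and
    the criterion [segre_ge_of_ranks] applies. *)
Lemma segre_semicontinuous n (A0 : 'M[C]_n) bs0 : has_jordan_form A0 bs0 ->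
  exists2 d : C, 0 < d & forall A bs, mx_close d A A0 -> has_jordan_form A bs ->
    segre_ge (segre_of_blocks bs) (segre_of_blocks bs0).
Proof.
move=> jf0.
(* Only finitely many powers of shifts of [A0] have to be approximated. *)
pose idx := [seq (mu, N) | mu <- unzip1 bs0, N <- iota 0 n.+1].
have [|x _|d1 d1_gt0 H1] := @exists_pos_all _ idx (fun x d => forall A ls,
    mx_close d A A0 -> size ls = x.2 -> all (fun l => `|l - x.1| < d) ls ->
    (\rank (shift_prod A0 (nseq x.2 x.1)) <= \rank (shift_prod A ls))%N).
- move=> x d d' d'd H A ls AA0 sz /allP als; apply: H => //.
    exact: mx_close_le AA0.
  by apply/allP => l /als h; apply: lt_le_trans d'd.
- have [d1 d1_gt0 H1] := rank_semicontinuous (shift_prod A0 (nseq x.2 x.1)).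
  have [d d_gt0 H2] := shift_prod_close A0 (nseq x.2 x.1) d1_gt0.
  exists d => // A ls AA0 sz als; apply: H1; apply: H2 => //.
  rewrite -sz; elim: ls als {sz} => //= l ls IH /andP[-> /IH ->] //.
(* [q0] lists the roots of the characteristic polynomial of [A0]; its value at
   a nearby matrix is small, hence so is its value at each eigenvalue. *)
pose q0 := flatten [seq nseq b.2 b.1 | b <- bs0].
have q00 : shift_prod A0 q0 = 0.
  apply/eqP; rewrite -mxrank_eq0 (rank_shift_prod _ jf0) big_seq big1 // => b bbs.
  apply/eqP; rewrite subn_eq0 count_flatten -map_comp sumnE big_map.
  by rewrite (big_rem b) //= count_nseq /= eqxx mul1n leq_addr.
have eta_gt0 : 0 < d1 ^+ size q0 / n.+1%:R :> C by rewrite divr_gt0 ?exprn_gt0 ?ltr0n.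
have [d2 d2_gt0 H2] := shift_prod_close A0 q0 eta_gt0.
have [d d_gt0 [dd1 dd2]] := exists_le2 d1_gt0 d2_gt0; exists d => // A bs AA0 jf.
have near0 a : a \in unzip1 bs -> has (fun mu => `|a - mu| < d1) (unzip1 bs0).
  move=> abs; apply: contraT => far.
  have [v v0 va] : exists2 v : 'rV[C]_n, v != 0 & v *m (A - a%:M) = 0.
    have : kermx (A - a%:M) != 0.
      rewrite kermx_eq0 /row_free ltn_eqF //.
      have := rank_shift_prod [:: a] jf; rewrite /= mulmx1 => ->.
      rewrite -[X in (_ < X)%N](sum_block_sizes jf).
      have /mapP[b bbs ab] := abs; rewrite (big_rem b) //= [X in (_ < X)%N](big_rem b) //=.
      rewrite -addSn leq_add //; last by apply: leq_sum => i _; exact: leq_subr.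
      have /allP/(_ b bbs) := jf.1; rewrite ab eqxx /=; lia.
    case/matrix0Pn => i [j kij]; exists (row i (kermx (A - a%:M))).
      by apply/matrix0Pn; exists 0, j; rewrite mxE.
    by rewrite -row_mul mulmx_ker row0.
  have close0 : mx_close (d1 ^+ size q0 / n.+1%:R) (shift_prod A q0) 0.
    rewrite -q00; apply: H2 (mx_close_le dd2 AA0) _.
    by elim: (q0) => //= l s ->; rewrite subrr normr0 d2_gt0.
  have /(row_small_entries (d := d1 ^+ size q0 / n.+1%:R)) := shift_prod_eigen q0 va.
  move=> /(_ _ v0) /=.
  have small i j : `|shift_prod A q0 i j| <= d1 ^+ size q0 / n.+1%:R.
    by have := close0 i j; rewrite mxE subr0 => /ltW.
  move/(_ small); rewrite normr_prod.
  have lower : d1 ^+ size q0 <= \prod_(l <- q0) `|a - l|.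
    have : all (fun l => d1 <= `|a - l|) q0.
      apply/allP => l /flatten_mapP[b bbs]; rewrite mem_nseq => /andP[_ /eqP ->].
      have /hasPn/(_ b.1 (map_f _ bbs)) := far.
      by rewrite /= -real_leNgt ?(gtr0_real d1_gt0) ?normr_real.
    elim: (q0) => [|l t IH] /=; first by rewrite big_nil expr0.
    case/andP=> dl /IH ds; rewrite big_cons exprS ler_pM ?exprn_ge0 //; exact: ltW.
  move=> /(le_trans lower); rewrite mulrCA -[leLHS]mulr1 ler_pM2l ?exprn_gt0 //.
  by rewrite ler_pdivlMr ?ltr0n // mul1r ler_nat ltnn.
pose phi a := nth 0 (unzip1 bs0) (find (fun mu => `|a - mu| < d1) (unzip1 bs0)).
apply: (segre_ge_of_ranks (phi := phi) (n := n) jf.1 jf0.1).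
- exact: sum_block_sizes jf.
- exact: sum_block_sizes jf0.
- by move=> a /near0; rewrite /phi has_find => /mem_nth.
move=> mu e mu0 N Nn.
pose ls := flatten [seq nseq (e a) a | a <- undup (unzip1 bs) & phi a == mu].
have := H1 (mu, N) _ A ls _ _ _; rewrite (rank_shift_prod _ jf) (rank_shift_prod _ jf0) /=.
have -> : (\sum_(b <- bs0) (b.2 - count_mem b.1 (nseq N mu)) =
          \sum_(b <- bs0) (b.2 - (b.1 == mu) * N))%N.
  by apply: eq_bigr => b _; rewrite count_nseq /= eq_sym.
have -> : (\sum_(b <- bs) (b.2 - count_mem b.1 ls) =
          \sum_(b <- bs) (b.2 - (phi b.1 == mu) * e b.1))%N.
  rewrite big_seq [RHS]big_seq; apply: eq_bigr => b bbs; congr (_ - _)%N.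
  rewrite count_flatten -map_comp sumnE big_map big_filter.
  have b1 : b.1 \in undup (unzip1 bs) by rewrite mem_undup map_f.
  rewrite big_mkcond (bigD1_seq b.1) ?undup_uniq //= big1 => [|a ab].
    by rewrite addn0 count_nseq /= eqxx mul1n; case: (phi b.1 == mu); rewrite ?mul1n.
  by rewrite count_nseq /= (negPf ab) if_same.
apply.
- by apply: allpairs_f => //; rewrite mem_iota add0n ltnS.
- exact: mx_close_le AA0.
- rewrite size_flatten /shape -map_comp sumnE big_map big_filter.
  by apply: eq_bigr => a _ /=; rewrite size_nseq.
apply/allP => l /flatten_mapP[a]; rewrite mem_filter mem_undup => /andP[/eqP <- /near0 na].
by rewrite mem_nseq => /andP[_ /eqP ->]; apply: (nth_find 0 na).
Qed.

End LocalSemicontinuity.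

(** * Generic Segre symbol of a polynomial family *)

Section StrongMinimality.
Variable C : closedFieldType.

(** The polynomial function of the variable of index 0 defined by a term. An
    environment with a single entry gives the other variables the value 0, and
    inverses are absent after translation to the language of rings. *)
Fixpoint term_poly (t : GRing.term C) : {poly C} :=
  match t with
  | GRing.Var i => if i is 0%N then 'X else 0
  | GRing.Const c => c%:P
  | GRing.NatConst k => k%:R
  | GRing.Add t1 t2 => term_poly t1 + term_poly t2
  | GRing.Opp t1 => - term_poly t1
  | GRing.NatMul t1 k => term_poly t1 *+ k
  | GRing.Mul t1 t2 => term_poly t1 * term_poly t2
  | GRing.Exp t1 k => term_poly t1 ^+ k
  | GRing.Inv _ => 0
  end.

Lemma eval_term_poly t x : GRing.rterm t -> GRing.eval [:: x] t = (term_poly t).[x].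
Proof.
elim: t => //=.
- by case=> [|i] _; rewrite ?hornerX //= nth_nil horner0.
- by move=> c _; rewrite hornerC.
- by move=> k _; rewrite -polyC_natr hornerC.
- by move=> t1 IH1 t2 IH2 /andP[/IH1 -> /IH2 ->]; rewrite hornerD.
- by move=> t1 IH1 /IH1 ->; rewrite hornerN.
- by move=> t1 IH1 k /IH1 ->; rewrite hornerMn.
- by move=> t1 IH1 t2 IH2 /andP[/IH1 -> /IH2 ->]; rewrite hornerM.
- by move=> t1 IH1 k /IH1 ->; rewrite horner_exp.
Qed.

Definition generically (P : C -> bool) := exists2 b : {poly C}, b != 0 &
  exists v : bool, forall t, b.[t] != 0 -> P t = v.

Lemma generically2 (P Q : C -> bool) (op : bool -> bool -> bool) :
  generically P -> generically Q -> generically (fun t => op (P t) (Q t)).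
Proof.
move=> [b1 b10 [v1 H1]] [b2 b20 [v2 H2]]; exists (b1 * b2); first by rewrite mulf_neq0.
exists (op v1 v2) => t; rewrite hornerM mulf_eq0 negb_or => /andP[h1 h2].
by rewrite H1 // H2.
Qed.

Lemma generically_qf (f : GRing.formula C) :
  GRing.qf_form f -> GRing.rformula f -> generically (fun t => GRing.qf_eval [:: t] f).
Proof.
elim: f => //=.
- by move=> v _ _; exists 1; [exact: oner_neq0 | exists v].
- move=> t1 t2 _ /andP[r1 r2].
  have [eq12|ne12] := eqVneq (term_poly t1) (term_poly t2).
    exists 1; first exact: oner_neq0.
    by exists true => t _; rewrite !eval_term_poly // eq12 eqxx.
  exists (term_poly t1 - term_poly t2); first by rewrite subr_eq0.
  exists false => t; rewrite hornerD hornerN subr_eq0 !eval_term_poly //.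
  exact: negPf.
- by move=> f IHf g IHg /andP[qf qg] /andP[rf rg]; apply: generically2 (IHf _ _) (IHg _ _).
- by move=> f IHf g IHg /andP[qf qg] /andP[rf rg]; apply: generically2 (IHf _ _) (IHg _ _).
- move=> f IHf g IHg /andP[qf qg] /andP[rf rg].
  exact: generically2 (IHf _ _) (IHg _ _).
- by move=> f IHf qf rf; apply: (generically2 (fun x _ => ~~ x) (IHf qf rf) (IHf qf rf)).
Qed.

(** Strong minimality: quantifier elimination makes every definable condition
    on one parameter hold either for almost all values or for almost none. *)
Lemma generically_holds (f : GRing.formula C) : exists2 b : {poly C}, b != 0 &
  forall t1 t2, b.[t1] != 0 -> b.[t2] != 0 ->
    GRing.holds [:: t1] f -> GRing.holds [:: t2] f.
Proof.
pose g := GRing.quantifier_elim (@ClosedFieldQE.ex_elim C) (GRing.to_rform f).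
have rf := GRing.to_rform_rformula f.
have /andP[qg rg] : GRing.qf_form g && GRing.rformula g.
  exact: GRing.quantifier_elim_wf (@ClosedFieldQE.wf_ex_elim C) _ rf.
have gP e : reflect (GRing.holds e (GRing.to_rform f)) (GRing.qf_eval e g).
  apply: GRing.quantifier_elim_rformP rf.
    exact: ClosedFieldQE.wf_ex_elim.
  by apply: ClosedFieldQE.holds_ex_elim; exact: GRing.solve_monicpoly.
have [b b0 [v bv]] := generically_qf qg rg; exists b => // t1 t2 bt1 bt2.
move=> /GRing.to_rformP/gP; rewrite bv // => vT; apply/GRing.to_rformP/gP.
by rewrite bv.
Qed.

End StrongMinimality.

Section RankTable.
Variable C : numClosedFieldType.

Definition eval_mxpoly m n (t : C) (A : 'M[{poly C}]_(m, n)) : 'M[C]_(m, n) :=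
  map_mx (horner^~ t) A.

(** [horner_eval] carries the ring morphism structure of evaluation. *)
Lemma eval_mxpolyE m n (t : C) (A : 'M[{poly C}]_(m, n)) :
  eval_mxpoly t A = map_mx (horner_eval t) A.
Proof. by []. Qed.

(** When the [a i] are all the eigenvalues, the table determines the Segre symbol
    while leaving the eigenvalues free; quantifying over them is what makes
    the Segre symbol definable by a first-order formula. *)
Definition has_rank_table r n (R : {ffun 'I_r * 'I_n.+1 -> 'I_n.+1}) (M : 'M[C]_n) :=
  exists2 a : 'I_r -> C, injective a &
    forall (i : 'I_r) (j : 'I_n.+1), \rank (shift_prod M (nseq j (a i))) = R (i, j).

Import MatrixFormula.

(** The Horner scheme in the variable of index 0. *)
Definition poly_term (p : seq C) : GRing.term C :=
  foldr (fun c t => GRing.Add (GRing.Mul t (GRing.Var _ 0)) (GRing.Const c))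
    (GRing.Const 0) p.

Lemma eval_poly_term e (p : {poly C}) : GRing.eval e (poly_term p) = p.[e`_0].
Proof.
by rewrite /horner; elim: (polyseq p) => //= c s ->.
Qed.

Definition shift_term n (M : 'M[GRing.term C]_n) (a : nat) : 'M[GRing.term C]_n :=
  \matrix_(i, j) GRing.Add (M i j) (GRing.Opp (GRing.NatMul (GRing.Var _ a) (i == j))).

Lemma eval_shift_term e n (M : 'M[GRing.term C]_n) a :
  eval_mx e (shift_term M a) = eval_mx e M - (e`_a)%:M.
Proof. by apply/matrixP => i j; rewrite !mxE /=. Qed.

Definition shift_power_term n (M : 'M[GRing.term C]_n) (a k : nat) :=
  iter k (mulmx_term (shift_term M a)) (mx_term 1%:M).

Lemma eval_shift_power_term e n (M : 'M[GRing.term C]_n) a k :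
  eval_mx e (shift_power_term M a k) = shift_prod (eval_mx e M) (nseq k e`_a).
Proof.
elim: k => [|k IH] /=; first by rewrite eval_mx_term.
by rewrite eval_mulmx eval_shift_term IH.
Qed.

(** Variable 0 is the parameter of the family, variable [i + 1] the eigenvalue
    of index [i] in the table. *)
Definition rank_table_body r n (R : {ffun 'I_r * 'I_n.+1 -> 'I_n.+1})
    (A : 'M[{poly C}]_n) : GRing.formula C :=
  GRing.And
    (\big[GRing.And/GRing.Bool true]_(ij : 'I_r * 'I_r)
       GRing.Or (GRing.Bool (ij.1 == ij.2))
         (GRing.Not (GRing.Equal (GRing.Var _ ij.1.+1) (GRing.Var _ ij.2.+1))))
    (\big[GRing.And/GRing.Bool true]_(ij : 'I_r * 'I_n.+1)
       mxrank_form (R ij)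
         (shift_power_term (map_mx (fun p : {poly C} => poly_term p) A) ij.1.+1 ij.2)).

Definition rank_table_form r n (R : {ffun 'I_r * 'I_n.+1 -> 'I_n.+1})
    (A : 'M[{poly C}]_n) : GRing.formula C :=
  foldr GRing.Exists (rank_table_body R A) (iota 1 r).

Lemma rank_table_bodyP r n (R : {ffun 'I_r * 'I_n.+1 -> 'I_n.+1}) A e :
  GRing.holds e (rank_table_body R A) <->
  (forall i j : 'I_r, e`_i.+1 = e`_j.+1 -> i = j) /\
  (forall (i : 'I_r) (j : 'I_n.+1),
     \rank (shift_prod (eval_mxpoly e`_0 A) (nseq j e`_i.+1)) = R (i, j)).
Proof.
have qfA (I : finType) (F : I -> GRing.formula C) : (forall i, GRing.qf_form (F i)) ->
    GRing.qf_form (\big[GRing.And/GRing.Bool true]_i F i).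
  by move=> qF; rewrite ((big_morph (@GRing.qf_form _)) true andb) // big_andE; apply/forallP.
have qfb : GRing.qf_form (rank_table_body R A).
  by rewrite /= !qfA // => ij; rewrite mxrank_form_qf.
have evA : eval_mx e (map_mx (fun p : {poly C} => poly_term p) A) = eval_mxpoly e`_0 A.
  by apply/matrixP => i j; rewrite !mxE eval_poly_term.
split=> [/(GRing.qf_evalP _ qfb)|[inj rk]]; last apply/(GRing.qf_evalP _ qfb); move=> /=.
  rewrite !((big_morph (GRing.qf_eval e)) true andb) // !big_andE.
  case/andP=> /forallP inj /forallP rk; split=> i j.
    by have /= /orP[/eqP//|/eqP ne /ne] := inj (i, j).
  by have /= := rk (i, j); rewrite eval_mxrank eval_shift_power_term evA => /eqP.
rewrite !((big_morph (GRing.qf_eval e)) true andb) // !big_andE.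
apply/andP; split; apply/forallP => -[i j] /=.
  by case: eqVneq => //= ij; apply: contra ij => /eqP/inj/eqP.
by rewrite eval_mxrank eval_shift_power_term evA rk.
Qed.

Lemma rank_table_formP r n (R : {ffun 'I_r * 'I_n.+1 -> 'I_n.+1}) A t :
  GRing.holds [:: t] (rank_table_form R A) <-> has_rank_table R (eval_mxpoly t A).
Proof.
split=> [/GRing.foldExistsP[e tE /rank_table_bodyP[inj rk]]|[a inj rk]].
  have e0 : e`_0 = t by have := tE 0%N; rewrite inE mem_iota => /(_ isT) <-.
  by exists (fun i : 'I_r => e`_i.+1); rewrite -?e0.
apply/GRing.foldExistsP; exists (t :: [seq a i | i <- enum 'I_r]) => [i|].
  rewrite inE mem_iota add1n; case: i => [//|i] /=; rewrite ltnS -leqNgt => ri.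
  by rewrite nth_nil nth_default // size_map size_enum_ord.
have aE (i : 'I_r) : [seq a i | i <- enum 'I_r]`_i = a i.
  by rewrite (nth_map i) ?size_enum_ord // nth_ord_enum.
by apply/rank_table_bodyP; split=> i j /=; rewrite !aE //; apply: inj.
Qed.

Lemma sum_block_sizes_at n (M : 'M[C]_n) bs a : has_jordan_form M bs ->
  (\sum_(b <- bs | b.1 == a) b.2 + \rank (shift_prod M (nseq n a)) = n)%N.
Proof.
move=> jf; rewrite (rank_shift_prod _ jf) -[RHS](sum_block_sizes jf).
rewrite [RHS](bigID (fun b => b.1 == a)) /=; congr (_ + _)%N.
rewrite [RHS]big_mkcond big_seq [RHS]big_seq; apply: eq_bigr => b bbs.
rewrite count_nseq /= eq_sym; case: eqP => _ /=; last by rewrite mul0n subn0.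
apply/eqP; rewrite mul1n subn_eq0 -[leqRHS](sum_block_sizes jf).
by rewrite (big_rem b) //= leq_addr.
Qed.

(** Equal multiplicities force [phi] to be a bijection between the eigenvalues,
    so each fibre in [segre_ge_of_ranks] is a single eigenvalue. *)
Lemma segre_ge_of_rank_table n (M1 M2 : 'M[C]_n) bs1 bs2 (phi : C -> C) :
  has_jordan_form M1 bs1 -> has_jordan_form M2 bs2 ->
  {in unzip1 bs1 &, injective phi} ->
  (forall a j, a \in unzip1 bs1 -> (j <= n)%N ->
     \rank (shift_prod M1 (nseq j a)) = \rank (shift_prod M2 (nseq j (phi a)))) ->
  segre_ge (segre_of_blocks bs1) (segre_of_blocks bs2).
Proof.
move=> jf1 jf2 inj rk.
have multE a : a \in unzip1 bs1 ->
    (\sum_(b <- bs1 | b.1 == a) b.2 = \sum_(b <- bs2 | b.1 == phi a) b.2)%N.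
  move=> a1; apply/eqP; rewrite -(eqn_add2r (\rank (shift_prod M1 (nseq n a)))).
  by rewrite (sum_block_sizes_at _ jf1) rk // (sum_block_sizes_at _ jf2).
have phiP a : a \in unzip1 bs1 -> phi a \in unzip1 bs2.
  move=> a1; apply: contraT => na; have := multE a a1.
  have /mapP[b bbs ab] := a1; have /allP/(_ b bbs) := jf1.1.
  rewrite [in RHS]big_seq_cond [in RHS]big_pred0 => [|c]; last first.
    by apply: contraNF na => /andP[cbs /eqP <-]; apply: map_f.
  rewrite (big_rem b) //= ab eqxx; lia.
have cover mu : mu \in unzip1 bs2 ->
    exists2 a, a \in unzip1 bs1 & mu = phi a.
  move=> mu2; pose ims := [seq phi a | a <- undup (unzip1 bs1)].
  suff : mu \in ims by case/mapP=> a; rewrite mem_undup => ? ->; exists a.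
  apply: contraT => nmu; have /mapP[b bbs bmu] := mu2.
  have uims : uniq ims.
    rewrite map_inj_in_uniq ?undup_uniq // => x y; rewrite !mem_undup; exact: inj.
  have sum_ims : (\sum_(b <- bs2 | b.1 \in ims) b.2 = n)%N.
    rewrite -(sum_block_sizes jf1) (sum_over_eigenvalues _ xpredT (fun _ k => k)).
    transitivity (\sum_(nu <- ims) \sum_(b <- bs2 | b.1 == nu) b.2)%N.
      rewrite [RHS]big_seq (exchange_big_dep (fun b => b.1 \in ims)) /=; last first.
        by move=> nu c nui /eqP ->.
      apply: eq_bigr => c cims; rewrite (eq_bigl (fun nu => nu == c.1)) => [|nu]; last first.
        by rewrite eq_sym; case: eqVneq => [->|]; rewrite ?cims ?andbF.
      by rewrite -big_filter filter_pred1_uniq // big_seq1.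
    rewrite big_map [LHS]big_seq [RHS]big_seq; apply: eq_bigr => a.
    by rewrite mem_undup => /multE.
  have := sum_block_sizes jf2; rewrite (bigID (fun b => b.1 \in ims)) /= sum_ims.
  have /allP/(_ b bbs) := jf2.1; rewrite (big_rem b) //= -bmu nmu; lia.
apply: (segre_ge_of_ranks (phi := phi) (n := n) jf1.1 jf2.1).
- exact: sum_block_sizes jf1.
- exact: sum_block_sizes jf2.
- exact: phiP.
move=> mu e /cover[a a1 ->] N Nn.
have phiE b : b \in unzip1 bs1 -> (phi b == phi a) = (b == a).
  by move=> b1; apply/eqP/eqP => [/inj|->] //; apply.
have NE : N = e a.
  rewrite /N big_mkcond (bigD1_seq a) ?mem_undup ?undup_uniq ?eqxx //= big_seq_cond.
  rewrite big1 ?addn0 // => b; rewrite mem_undup => /andP[b1 ab].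
  by rewrite phiE // (negPf ab).
have := rk a N a1 Nn; rewrite (rank_shift_prod _ jf1) (rank_shift_prod _ jf2) => E.
apply/eq_leq; transitivity (\sum_(b <- bs2) (b.2 - count_mem b.1 (nseq N (phi a))))%N.
  by apply: eq_bigr => b _; rewrite count_nseq /= eq_sym.
rewrite -E [LHS]big_seq [RHS]big_seq; apply: eq_bigr => b bbs.
by rewrite count_nseq /= phiE ?map_f // NE eq_sym; case: eqVneq => // ->.
Qed.

Lemma size_undup_unzip1 n (M : 'M[C]_n) bs : has_jordan_form M bs ->
  (size (undup (unzip1 bs)) <= n)%N.
Proof.
move=> jf; apply: leq_trans (size_undup _) _; rewrite size_map.
rewrite -(sum_block_sizes jf); case: jf => + _; elim: bs => //= b bs IH /andP[b0 /IH le].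
by rewrite big_cons -add1n leq_add.
Qed.

(** There are finitely many rank tables, and each of them is realised by almost
    all members of the family or by almost none. *)
Lemma generic_segre n (A : 'M[{poly C}]_n) : exists2 b : {poly C}, b != 0 &
  forall t1 t2 bs1 bs2, b.[t1] != 0 -> b.[t2] != 0 ->
    has_jordan_form (eval_mxpoly t1 A) bs1 ->
    has_jordan_form (eval_mxpoly t2 A) bs2 ->
    segre_ge (segre_of_blocks bs1) (segre_of_blocks bs2).
Proof.
pose T := {r : 'I_n.+1 & {ffun 'I_r * 'I_n.+1 -> 'I_n.+1}}.
have /boolp.choice[b bP] : forall x : T, exists b : {poly C}, b != 0 /\
    forall t1 t2, b.[t1] != 0 -> b.[t2] != 0 ->
      has_rank_table (tagged x) (eval_mxpoly t1 A) ->
      has_rank_table (tagged x) (eval_mxpoly t2 A).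
  move=> x; have [b b0 bP] := generically_holds (rank_table_form (tagged x) A).
  exists b; split=> // t1 t2 h1 h2 /rank_table_formP/(bP _ _ h1 h2).
  by move/rank_table_formP.
exists (\prod_x b x); first by apply/prodf_neq0 => x _; have [] := bP x.
move=> t1 t2 bs1 bs2; rewrite !horner_prod => /prodf_neq0 h1 /prodf_neq0 h2 jf1 jf2.
pose E := undup (unzip1 bs1).
have ltE : (size E < n.+1)%N by rewrite ltnS (size_undup_unzip1 jf1).
pose r := Ordinal ltE.
pose R : {ffun 'I_r * 'I_n.+1 -> 'I_n.+1} := [ffun ij : 'I_r * 'I_n.+1 =>
  inord (\rank (shift_prod (eval_mxpoly t1 A) (nseq ij.2 E`_ij.1)))].
have tab1 : has_rank_table R (eval_mxpoly t1 A).
  exists (fun i : 'I_r => E`_i) => [i j /eqP|i j].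
    by rewrite nth_uniq ?undup_uniq // => /eqP/val_inj.
  by rewrite ffunE inordK // ltnS rank_leq_row.
have [a inj_a rk_a] := (bP (existT _ r R)).2 t1 t2 (h1 _ isT) (h2 _ isT) tab1.
pose a2s := [seq a i | i <- enum 'I_r].
pose phi x := a2s`_(index x E).
have phiE x (xE : x \in E) : phi x = a (Ordinal (etrans (index_mem x E) xE)).
  rewrite /phi /a2s (nth_map (Ordinal (etrans (index_mem x E) xE))).
    by congr a; apply: val_inj; rewrite /= nth_enum_ord // index_mem.
  by rewrite size_enum_ord index_mem.
apply: (segre_ge_of_rank_table (phi := phi) jf1 jf2) => [x y|x j].
  rewrite -!(mem_undup (unzip1 bs1)) -/E => xE yE; rewrite !phiE => /inj_a[exy].
  by rewrite -(nth_index 0 xE) exy nth_index.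
rewrite -mem_undup -/E => xE jn; rewrite phiE.
have := rk_a (Ordinal (etrans (index_mem x E) xE)) (Ordinal (jn : (j < n.+1)%N)).
by rewrite ffunE /= nth_index // inordK ?ltnS ?rank_leq_row // => ->.
Qed.

End RankTable.

(** * Maximal Segre symbols exist *)

Section SegreWeight.
Local Open Scope nat_scope.
Implicit Types (p q : seq nat) (s : {mset seq nat}).

(** The coefficients [i + 1] make the weight grow strictly when a partition is
    replaced by one that it dominates; the sum being additive under merging,
    the decrement provides the strict growth there. *)
Definition partition_weight p := (\sum_(i < size p) i.+1 * nth 0 p i).-1.

Definition segre_weight s := \sum_(p <- s) partition_weight p.

Lemma sum_nth_weight p K : size p <= K ->
  \sum_(i < size p) i.+1 * nth 0 p i = \sum_(i < K) i.+1 * nth 0 p i.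
Proof.
move=> leK; rewrite -!(big_mkord xpredT (fun i => i.+1 * nth 0 p i)).
rewrite [RHS](@big_cat_nat _ _ _ (size p)) //= [X in _ = _ + X]big_nat_cond.
rewrite [X in _ = _ + X]big1 ?addn0 // => i /andP[/andP[? _] _].
by rewrite nth_default ?muln0.
Qed.

Lemma abel_summation (f : nat -> nat) K :
  \sum_(i < K) i.+1 * f i + \sum_(k < K) \sum_(i < k) f i = K * \sum_(i < K) f i.
Proof.
elim: K => [|K IH]; first by rewrite !big_ord0.
rewrite 3!big_ord_recr /= addnACA IH; ring.
Qed.

Lemma partition_weight_gt0 p : is_partition p ->
  0 < \sum_(i < size p) i.+1 * nth 0 p i.
Proof.
move=> pp; have /and3P[p0 _ _] := pp; have sp : 0 < size p by rewrite lt0n size_eq0.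
rewrite (bigD1 (Ordinal sp)) //= mul1n addn_gt0; apply/orP; left.
by rewrite partition_nth_gt0.
Qed.

Lemma partition_weight_add p q : is_partition p -> is_partition q ->
  partition_weight p + partition_weight q < partition_weight (partition_add p q).
Proof.
move=> pp qq; have := partition_weight_gt0 pp; have := partition_weight_gt0 qq.
rewrite /partition_weight (@sum_nth_weight p (maxn (size p) (size q))) ?leq_maxl //.
rewrite (@sum_nth_weight q (maxn (size p) (size q))) ?leq_maxr //.
rewrite (@sum_nth_weight (partition_add p q) (maxn (size p) (size q))) ?size_mkseq //.
have -> : \sum_(i < maxn (size p) (size q)) i.+1 * nth 0 (partition_add p q) i =
  \sum_(i < maxn (size p) (size q)) i.+1 * nth 0 p i +
  \sum_(i < maxn (size p) (size q)) i.+1 * nth 0 q i.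
  by rewrite -big_split; apply: eq_bigr => i _; rewrite nth_partition_add mulnDr.
by case: (bigop _ _ _) => // a; case: (bigop _ _ _) => // b; lia.
Qed.

Lemma partition_eq p q : is_partition p -> is_partition q ->
  nth 0 p =1 nth 0 q -> p = q.
Proof.
move=> pp qq pq; have sz i : (i < size p) = (i < size q).
  by rewrite -(partition_nth_gt0 _ pp) -(partition_nth_gt0 _ qq) pq.
apply: (@eq_from_nth _ 0) => // ; apply/eqP; rewrite eqn_leq.
by rewrite leqNgt sz ltnn leqNgt -sz ltnn.
Qed.

Lemma partition_weight_dominates p q :
  is_partition p -> is_partition q -> dominates p q ->
  p = q \/ partition_weight p < partition_weight q.
Proof.
move=> pp qq [totE dom]; pose K := maxn (size p) (size q).
have spK : size p <= K by exact: leq_maxl.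
have sqK : size q <= K by exact: leq_maxr.
have dom' k : \sum_(i < k) nth 0 q i <= \sum_(i < k) nth 0 p i by rewrite -!sumn_take.
have totE' : \sum_(i < K) nth 0 q i = \sum_(i < K) nth 0 p i.
  by rewrite -!sumn_take !take_oversize.
have abp := abel_summation (nth 0 p) K; have abq := abel_summation (nth 0 q) K.
have lepq : \sum_(k < K) \sum_(i < k) nth 0 q i <= \sum_(k < K) \sum_(i < k) nth 0 p i.
  by apply: leq_sum => k _; exact: dom'.
have [eqT|neT] := eqVneq (\sum_(k < K) \sum_(i < k) nth 0 q i)
                         (\sum_(k < K) \sum_(i < k) nth 0 p i).
  left; have partE k : \sum_(i < k) nth 0 q i = \sum_(i < k) nth 0 p i.
    have [ltk|leK] := ltnP k K; last first.
      by rewrite -!sumn_take !take_oversize // ?(leq_trans spK) ?(leq_trans sqK).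
    have [_] := leqif_sum (fun (k : 'I_K) (_ : true) => leqif_eq (dom' k)).
    by rewrite eqT eqxx => /esym/forallP/(_ (Ordinal ltk))/eqP.
  apply: partition_eq => // k; have := partE k.+1.
  by rewrite !big_ord_recr /= partE => /addnI.
right; have := partition_weight_gt0 pp; rewrite /partition_weight.
rewrite (sum_nth_weight spK) (sum_nth_weight sqK); move: neT lepq abp abq; rewrite totE'.
set a := \sum_(k < K) \sum_(i < k) _; set b := \sum_(k < K) \sum_(i < k) _.
by move: a b => a b; case: (bigop _ _ _) => // c; case: (bigop _ _ _) => [|d]; lia.
Qed.

Lemma segre_weightD s u :
  segre_weight (s `+` u)%mset = segre_weight s + segre_weight u.
Proof.
rewrite /segre_weight -big_cat; apply: perm_big.
by apply/eq_seq_msetP; rewrite seq_mset_cat !seq_mset_id.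
Qed.

Lemma segre_weight1 p : segre_weight [mset p]%mset = partition_weight p.
Proof. by rewrite /segre_weight big_msetn. Qed.

(** Hence the order is antisymmetric, and the elements of minimal weight of any
    set of symbols are maximal in it. *)
Lemma segre_ge_weight s s' :
  segre_ge s s' -> s = s' \/ segre_weight s < segre_weight s'.
Proof.
elim=> {s s'} [s s' [{}s p q pp qq|{}s p q pp qq dom]|s|s1 s2 s3 _ H1 _ H2].
- by right; rewrite !segre_weightD !segre_weight1 -addnA ltn_add2l partition_weight_add.
- have [->|lt] := partition_weight_dominates pp qq dom; first by left.
  by right; rewrite !segre_weightD !segre_weight1 ltn_add2l.
- by left.
- case: H1 => [->|lt1] //; case: H2 => [<-|lt2]; right=> //.
  exact: ltn_trans lt1 lt2.
Qed.

End SegreWeight.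

Section MaximalSymbol.
Variable C : numClosedFieldType.

Lemma segre_maximal_exists n (L : {vspace 'M[C]_n}) U : U \in L ->
  exists s, segre_maximal (segre_symbols L U) s.
Proof.
move=> UL; pose S := segre_symbols L U.
have exS : exists k, `[< exists2 s, S s & segre_weight s = k >].
  have [bs jf] := jordan_form_exists (U *m invmx U).
  exists (segre_weight (segre_of_blocks bs)); apply/asboolP.
  by exists (segre_of_blocks bs) => //; exists U => //; exists bs.
have [_ /asboolP[s Ss <-] smin] := find_ex_minn exS.
exists s; split=> // s' Ss' /segre_ge_weight[//|].
rewrite ltnNge smin //; apply/asboolP; by exists s'.
Qed.

Lemma jordan_segre_symbolP n (L : {vspace 'M[C]_n}) : is_jordan_space L ->
  exists U, [/\ U \in L, U \in unitmx &
    segre_maximal (segre_symbols L U) (jordan_segre_symbol L)].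
Proof.
case=> _ [U [UL Uu _]]; rewrite /jordan_segre_symbol.
case: xgetP => [s _ //|noS]; have [s maxs] := segre_maximal_exists UL.
by case: (noS s); exists U.
Qed.

End MaximalSymbol.

(** * The maximal Segre symbol of a linear family is its greatest one *)

Section GreatestSymbol.
Variable C : numClosedFieldType.

Lemma horner_close (p : {poly C}) (t0 eps : C) : 0 < eps ->
  exists2 d : C, 0 < d & forall t, `|t - t0| < d -> `|p.[t] - p.[t0]| < eps.
Proof.
elim/poly_ind: p eps => [|p c IH] eps eps_gt0.
  by exists 1 => // t _; rewrite !horner0 subrr normr0.
have [d1 d1_gt0 H1] := mulmx_close (p.[t0]%:M : 'M_1) (t0%:M : 'M_1) eps_gt0.
have [d2 d2_gt0 H2] := IH _ d1_gt0.
have [d d_gt0 [dd1 dd2]] := exists_le2 d1_gt0 d2_gt0; exists d => // t tt0.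
have -> : (p * 'X + c%:P).[t] - (p * 'X + c%:P).[t0] = p.[t] * t - p.[t0] * t0.
  by rewrite !hornerE; ring.
have := H1 (p.[t]%:M) (t%:M) _ _ 0 0.
rewrite -!scalar_mxM !mxE eqxx !mulr1n; apply=> i j.
  by rewrite !mxE (ord1 i) (ord1 j) eqxx !mulr1n; apply: H2; apply: lt_le_trans dd2.
by rewrite !mxE (ord1 i) (ord1 j) eqxx !mulr1n; apply: lt_le_trans dd1.
Qed.

Lemma mx_close_near m n (f : C -> 'M[C]_(m, n)) (M : 'M[C]_(m, n)) (t0 eps : C) :
  (forall i j, exists2 d : C, 0 < d &
    forall t, `|t - t0| < d -> `|f t i j - M i j| < eps) ->
  exists2 d : C, 0 < d & forall t, `|t - t0| < d -> mx_close eps (f t) M.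
Proof.
move=> fM; have [x d d' d'd H t tt0|x _|d d_gt0 H] := @exists_pos_all C _
    (enum {: 'I_m * 'I_n})
    (fun x d => forall t, `|t - t0| < d -> `|f t x.1 x.2 - M x.1 x.2| < eps).
- by apply: H; apply: lt_le_trans d'd.
- exact: fM.
by exists d => // t tt0 i j; apply: (H (i, j)) => //; rewrite mem_enum.
Qed.

Lemma eval_mxpoly_close m n (A : 'M[{poly C}]_(m, n)) (t0 eps : C) : 0 < eps ->
  exists2 d : C, 0 < d & forall t, `|t - t0| < d ->
    mx_close eps (eval_mxpoly t A) (eval_mxpoly t0 A).
Proof.
move=> eps_gt0; apply: mx_close_near => i j.
have [d d_gt0 H] := horner_close (A i j) t0 eps_gt0.
by exists d => // t /H; rewrite !mxE.
Qed.

Lemma nonroot_near (b : {poly C}) (t0 d : C) : b != 0 -> 0 < d ->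
  exists t, [/\ b.[t] != 0, `|t - t0| < d & t != t0].
Proof.
move=> b0 d_gt0; pose x (k : nat) := t0 + d / k.+2%:R.
have xinj : injective x.
  move=> k l /addrI/(mulfI (lt0r_neq0 d_gt0))/invr_inj/eqP.
  by rewrite eqr_nat => /eqP[].
have [k /= bk] : exists k, ~~ root b (x k).
  apply: contrapT => noex.
  have all_root k : root b (x k) by apply: contrapT => /negP h; apply: noex; exists k.
  have := max_poly_roots b0 (rs := [seq x k | k <- iota 0 (size b)]).
  rewrite size_map size_iota ltnn map_inj_uniq ?iota_uniq // => H.
  by have : false by apply: H => //; apply/allP => _ /mapP[k _ ->].
exists (x k); split=> //.
  rewrite /x addrC addKr ger0_norm ?divr_ge0 ?ltW ?ler0n //.
  by rewrite ltr_pdivrMr ?ltr0n // -[ltLHS]mulr1 ltr_pM2l // ltr1n.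
by rewrite /x -subr_eq0 addrC addKr mulf_neq0 ?invr_neq0 ?pnatr_eq0 // lt0r_neq0.
Qed.

(** The generic symbol of the line joining two elements is at least the symbol
    of either one, by semicontinuity; maximality of the first turns the first
    of these comparisons into an equality. *)
Lemma segre_maximal_greatest n (L : {vspace 'M[C]_n}) U s s' :
  segre_maximal (segre_symbols L U) s -> segre_symbols L U s' -> segre_ge s s'.
Proof.
move=> [[X XL [bsX jfX sE]] smax] [Y YL [bsY jfY s'E]].
pose A := map_mx polyC (X *m invmx U) + 'X *: map_mx polyC ((Y - X) *m invmx U).
have AE t : eval_mxpoly t A = (X + t *: (Y - X)) *m invmx U.
  rewrite mulmxDl -scalemxAl; apply/matrixP => i j.
  by rewrite !mxE !hornerE [RHS]addrC addrC mulrC.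
have [b b0 gen] := generic_segre A.
have near_sym t0 Z bs0 : has_jordan_form (Z *m invmx U) bs0 ->
    eval_mxpoly t0 A = Z *m invmx U ->
    exists t bs, [/\ b.[t] != 0, has_jordan_form (eval_mxpoly t A) bs &
      segre_ge (segre_of_blocks bs) (segre_of_blocks bs0)].
  move=> jf0 Z0; have [d d_gt0 H] := segre_semicontinuous jf0.
  have [e e_gt0 He] : exists2 e : C, 0 < e & forall t, `|t - t0| < e ->
      mx_close d (eval_mxpoly t A) (Z *m invmx U).
    by rewrite -Z0; exact: eval_mxpoly_close.
  have [t [bt tt0 _]] := nonroot_near t0 b0 e_gt0.
  have [bs jf] := jordan_form_exists (eval_mxpoly t A).
  by exists t, bs; split=> //; apply: H jf; exact: He.
have [|t1 [bs1 [bt1 jf1 ge1]]] := near_sym 0 X bsX jfX.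
  by rewrite AE scale0r addr0.
have [|t2 [bs2 [bt2 jf2 ge2]]] := near_sym 1 Y bsY jfY.
  by rewrite AE scale1r addrC subrK.
have <- : segre_of_blocks bs1 = s.
  apply: smax; last by rewrite sE.
  exists (X + t1 *: (Y - X)); last by exists bs1 => //; rewrite -AE.
  by rewrite rpredD ?rpredZ ?rpredB.
by apply: segre_ge_trans (gen _ _ _ _ bt1 bt2 jf1 jf2) _; rewrite s'E.
Qed.

End GreatestSymbol.

(** * Independence of the chosen unit *)

Section SquareRoot.
Variable C : numClosedFieldType.

(** Hensel lifting, one linear factor at a time: adding [c * q] to a root [p]
    modulo [q] gains the factor ['X - l] once [c] solves an equation over [C],
    quadratic when [q] does not vanish at [l] and linear otherwise. *)
Lemma sqrt_mod_prod (ls : seq C) : 0 \notin ls ->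
  exists p r : {poly C}, p ^+ 2 - 'X = (\prod_(l <- ls) ('X - l%:P)) * r.
Proof.
elim: ls => [|l ls IH]; first by exists 0, (- 'X); rewrite big_nil mul1r expr0n sub0r.
rewrite inE negb_or eq_sym => /andP[l0 /IH[p [r prE]]].
rewrite big_cons; set q := bigop _ _ _ in prE *.
have at_l : p.[l] ^+ 2 - l = q.[l] * r.[l].
  by have := congr1 (horner^~ l) prE; rewrite !hornerE.
have [c cE] : exists c, r.[l] + 2 * c * p.[l] + c ^+ 2 * q.[l] = 0.
  have [q0|q0] := eqVneq q.[l] 0.
    have p0 : p.[l] != 0.
      apply: contraNneq l0 => p0; move/eqP: at_l.
      by rewrite p0 q0 mul0r expr0n sub0r oppr_eq0.
    exists (- r.[l] / (2 * p.[l])); rewrite q0 mulr0 addr0.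
    by field; rewrite ?p0 ?pnatr_eq0.
  exists ((sqrtC l - p.[l]) / q.[l]).
  move: at_l; rewrite -{2}(sqrtCK l); move: p.[l] q.[l] r.[l] (sqrtC l) q0.
  move=> P Q S T Q0 at_l; have -> : S = (P ^+ 2 - T ^+ 2) / Q.
    by rewrite at_l mulrAC mulfV ?mul1r.
  by field.
have /factor_theorem[r' r'E] : root (r + (2 * c)%:P * p + (c ^+ 2)%:P * q) l.
  by apply/eqP; rewrite !hornerE.
exists (p + c%:P * q), r'.
have -> : (p + c%:P * q) ^+ 2 - 'X =
    (p ^+ 2 - 'X) + q * ((2 * c)%:P * p + (c ^+ 2)%:P * q).
  by rewrite polyCM rmorphXn /= polyC_natr; ring.
by rewrite prE -mulrDr addrA r'E; ring.
Qed.

Lemma matrix_sqrt n (A : 'M[C]_n.+1) : A \in unitmx ->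
  exists p, horner_mx A p *m horner_mx A p = A.
Proof.
move=> Au; have [ls pE] := closed_field_poly_normal (char_poly A).
rewrite (monicP (char_poly_monic A)) scale1r in pE.
have ls0 : 0 \notin ls.
  rewrite -root_prod_XsubC -pE -eigenvalue_root_char.
  apply/negP => /eigenvalueP[v vA v0].
  by case/eqP: v0; rewrite -[v](mulmxK Au) vA scale0r mul0mx.
have [p [r prE]] := sqrt_mod_prod ls0; exists p.
have := congr1 (horner_mx A) prE; rewrite -pE rmorphM /= Cayley_Hamilton mul0r.
by rewrite rmorphB rmorphXn /= horner_mx_X => /eqP; rewrite subr_eq0 expr2 => /eqP.
Qed.

End SquareRoot.

Section UnitIndependence.
Variable C : numClosedFieldType.

Definition jordan_unit n (L : {vspace 'M[C]_n}) (U : 'M[C]_n) :=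
  forall X Y, X \in L -> Y \in L ->
    2^-1 *: (X *m invmx U *m Y + Y *m invmx U *m X) \in L.

Section JordanAlgebra.
Variables (n : nat) (L : {vspace 'M[C]_n}) (U : 'M[C]_n).
Hypotheses (Uu : U \in unitmx) (Ujord : jordan_unit L U).

Let J x := x *m U \in L.

Lemma jordan_sym x y : J x -> J y -> J (x *m y + y *m x).
Proof.
move=> Jx Jy; have := Ujord Jx Jy.
have -> : x *m U *m invmx U *m (y *m U) + y *m U *m invmx U *m (x *m U) =
    (x *m y + y *m x) *m U by rewrite !mulmxK // mulmxDl !mulmxA.
by move/(rpredZ (2%:R : C)); rewrite scalerA mulfV ?scale1r // pnatr_eq0.
Qed.

Lemma jordan_half x : J (x + x) -> J x.
Proof.
rewrite /J -mulr2n -scaler_nat -scalemxAl => /(rpredZ (2%:R^-1 : C)).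
by rewrite scalerA mulVf ?scale1r // pnatr_eq0.
Qed.

Lemma jordanD x y : J x -> J y -> J (x + y).
Proof. by rewrite /J mulmxDl; apply: rpredD. Qed.

Lemma jordanN x : J x -> J (- x).
Proof. by rewrite /J mulNmx rpredN. Qed.

(** Indeed [2 w x w = w (w x + x w) + (w x + x w) w - (w^2 x + x w^2)]. *)
Lemma jordan_quadratic w x : J w -> J (w *m w) -> J x -> J (w *m x *m w).
Proof.
move=> Jw Jw2 Jx; have Jy := jordan_sym Jw Jx.
apply: jordan_half.
have -> : w *m x *m w + w *m x *m w =
    (w *m (w *m x + x *m w) + (w *m x + x *m w) *m w) -
    ((w *m w) *m x + x *m (w *m w)).
  by rewrite mulmxDr mulmxDl !mulmxA [X in X + _ - _]addrC addrACA addrK.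
by apply: jordanD; [apply: jordan_sym | apply/jordanN/jordan_sym].
Qed.

End JordanAlgebra.

Lemma jordan_horner n (L : {vspace 'M[C]_n.+1}) U v p :
  U \in L -> U \in unitmx -> jordan_unit L U ->
  v *m U \in L -> horner_mx v p *m U \in L.
Proof.
move=> UL Uu Uj vL; elim/poly_ind: p => [|p c IH].
  by rewrite rmorph0 mul0mx rpred0.
rewrite rmorphD /= horner_mx_C mulmxDl mul_scalar_mx rpredD ?rpredZ //.
apply: jordan_half => //; rewrite {1}mulrC !rmorphM /= horner_mx_X.
exact: (jordan_sym Uu Uj vL IH).
Qed.

(** If [w] is a square root of [v = V U^-1], then [w x w] ranges over the
    Jordan algebra [L U^-1] with [x], and [w x w v^-1 = w x w^-1]: the spaces
    [L U^-1] and [L V^-1] are conjugate. *)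
Lemma segre_symbols_unit n (L : {vspace 'M[C]_n}) U V :
  U \in L -> U \in unitmx -> jordan_unit L U -> V \in L -> V \in unitmx ->
  forall s, segre_symbols L U s <-> segre_symbols L V s.
Proof.
case: n L U V => [|n] L U V UL Uu Uj VL Vu s.
  by rewrite /segre_symbols (_ : U = V) // [U]flatmx0 [V]flatmx0.
pose v := V *m invmx U.
have vu : v \in unitmx by rewrite unitmx_mul Vu unitmx_inv.
have [p wE] := matrix_sqrt vu; set w := horner_mx v p in wE.
have wu : w \in unitmx by move: vu; rewrite -wE unitmx_mul => /andP[].
have vUV : v *m U = V by rewrite mulmxKV.
have Jv : v *m U \in L by rewrite vUV.
have Jw : w *m U \in L by apply: jordan_horner.
(* [f] is the map [x |-> w x w], transported to [L] by [X = x U]. *)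
pose f : 'End('M[C]_n.+1) := linfun (mulmxr (invmx U *m w *m U) \o mulmx w).
have fE X : f X = w *m (X *m invmx U) *m w *m U by rewrite lfunE /= !mulmxA.
have fL X : X \in L -> f X \in L.
  move=> XL; rewrite fE; apply: (jordan_quadratic Uu Uj) => //; first by rewrite wE.
  by rewrite mulmxKV.
have fI : lker f == 0%VS.
  apply/lker0P => X Y; rewrite !fE => /(can_inj (mulmxK Uu))/(can_inj (mulmxK wu)).
  by move/(can_inj (mulKmx wu))/(can_inj (mulmxK _)); apply; rewrite unitmx_inv.
have fLL : (f @: L)%VS = L.
  apply/eqP; rewrite eqEdim; apply/andP; split.
    by apply/subvP => _ /memv_imgP[X XL ->]; exact: fL.
  by rewrite limg_dim_eq // (eqP fI) capv0.
have conj X : f X *m invmx V = w *m (X *m invmx U) *m invmx w.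
  rewrite fE -vUV -wE; apply: (can_inj (mulmxK (_ : w *m w *m U \in unitmx))).
    by rewrite !unitmx_mul wu Uu.
  by rewrite mulmxKV ?unitmx_mul ?wu ?Uu // !mulmxA mulmxKV.
split=> [[X XL [bs jf sE]]|[Z ZL [bs jf sE]]].
  exists (f X); first exact: fL.
  exists bs => //; rewrite conj; apply: (jordan_form_conj _ _ (erefl _) jf).
    exact: mulmxV.
  exact: mulVmx.
have := ZL; rewrite -{1}fLL => /memv_imgP[X XL ZE]; exists X => //.
exists bs => //; apply: (jordan_form_conj (P := invmx w) (P' := w) _ _ _ jf).
- exact: mulVmx.
- exact: mulmxV.
- by rewrite ZE conj !mulmxA mulVmx // mul1mx mulmxKV.
Qed.

End UnitIndependence.

(** * Degenerations *)

Section Degeneration.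
Variable C : numClosedFieldType.
Local Notation frac := {fraction {poly C}}.
Local Open Scope classical_set_scope.

Lemma laurent_mx_clear m n (P : 'M[frac]_(m, n)) : laurent_mx P ->
  exists (K : nat) (P' : 'M[{poly C}]_(m, n)),
    tofrac ('X^K) *: P = map_mx (@tofrac _) P'.
Proof.
move=> lP; have /boolp.choice[pk pkE] : forall ij : 'I_m * 'I_n,
    exists pk : {poly C} * nat, P ij.1 ij.2 = tofrac pk.1 / tofrac ('X^(pk.2)).
  by move=> ij; have [p [k E]] := lP ij.1 ij.2; exists (p, k).
pose K := (\sum_ij (pk ij).2)%N.
have leK ij : ((pk ij).2 <= K)%N by rewrite /K (bigD1 ij) //= leq_addr.
exists K, (\matrix_(i, j) ((pk (i, j)).1 * 'X^(K - (pk (i, j)).2))).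
apply/matrixP => i j; rewrite !mxE (pkE (i, j)) /= rmorphM /=.
rewrite -{1}(subnK (leK (i, j))) exprD rmorphM /= mulrC -!mulrA; congr (_ * _).
rewrite mulrCA mulVf ?mulr1 // tofrac_eq0 expf_neq0 // polyX_eq0 //.
Qed.

(** Clearing denominators turns the Laurent identities into polynomial ones,
    which can be evaluated at every parameter. *)
Lemma degeneration_polynomial m n (X : m.-tuple 'M[C]_n) (P : 'M[frac]_n)
    (Q : 'M[frac]_m) (Y : 'I_m -> 'M[{poly C}]_n) :
  laurent_mx P -> laurent_mx Q ->
  (forall i, degeneration_family X P Q i = map_mx (@tofrac _) (Y i)) ->
  exists K (P' : 'M[{poly C}]_n) (Q' : 'M[{poly C}]_m), forall i,
    'X^K *: Y i = \sum_j Q' j i *: (P' *m map_mx polyC (tnth X j) *m P'^T).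
Proof.
move=> /laurent_mx_clear[KP [P' PE]] /laurent_mx_clear[KQ [Q' QE]] famE.
exists (KQ + (KP + KP))%N, P', Q' => i.
suff : map_mx (@tofrac _) ('X^(KQ + (KP + KP)) *: Y i) =
    map_mx (@tofrac _) (\sum_j Q' j i *: (P' *m map_mx polyC (tnth X j) *m P'^T)).
  by move/matrixP => E; apply/matrixP => a b; have := E a b; rewrite !mxE => /eqP;
    rewrite tofrac_eq => /eqP.
rewrite map_mxZ -famE /degeneration_family scaler_sumr [RHS]raddf_sum /=.
apply: eq_bigr => j _; rewrite map_mxZ !map_mxM -map_trmx -PE -map_mx_comp /=.
have -> : tofrac (Q' j i) = tofrac 'X^KQ * Q j i.
  by have /matrixP/(_ j i) := QE; rewrite !mxE => <-.
rewrite [(_ *: P)^T]linearZ /= -!scalemxAl -scalemxAr !scalerA !exprD !rmorphM /=.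
by congr (_ *: _); ring.
Qed.

Lemma inv_close (x0 eps : C) : x0 != 0 -> 0 < eps ->
  exists2 d : C, 0 < d & forall x, `|x - x0| < d -> `|x^-1 - x0^-1| < eps.
Proof.
move=> x00 eps_gt0; have n0 : 0 < `|x0| by rewrite normr_gt0.
have h1 : 0 < `|x0| / 2 by rewrite divr_gt0.
have h2 : 0 < eps * (`|x0| / 2 * `|x0|) by apply: mulr_gt0 => //; apply: mulr_gt0.
have [d d_gt0 [d1 d2]] := exists_le2 h1 h2; exists d => // x xx0.
have xn : `|x0| / 2 <= `|x|.
  have := lerB_dist x0 (x0 - x); rewrite subKr => /(le_trans _); apply.
  rewrite distrC lerBrDr -lerBrDl; apply: le_trans (ltW (lt_le_trans xx0 d1)) _.
  by rewrite {2}(splitr `|x0|) addrK.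
have x0' : x != 0 by rewrite -normr_gt0 (lt_le_trans h1).
have -> : x^-1 - x0^-1 = (x0 - x) / (x * x0) by field; rewrite x00 x0'.
rewrite normrM normfV normrM ltr_pdivrMr ?mulr_gt0 ?normr_gt0 //.
rewrite distrC; apply: lt_le_trans (lt_le_trans xx0 d2) _.
by rewrite ler_pM2l // ler_pM2r.
Qed.

(** By Cramer's rule the only division is by the scalar [\det B], which does
    not vanish near [t0]. *)
Lemma eval_mxpoly_div_close n (A B : 'M[{poly C}]_n) (t0 eps : C) :
  eval_mxpoly t0 B \in unitmx -> 0 < eps ->
  exists2 d : C, 0 < d & forall t, `|t - t0| < d -> eval_mxpoly t B \in unitmx ->
    mx_close eps (eval_mxpoly t A *m invmx (eval_mxpoly t B))
      (eval_mxpoly t0 A *m invmx (eval_mxpoly t0 B)).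
Proof.
move=> B0u eps_gt0.
have detE t : \det (eval_mxpoly t B) = (\det B).[t].
  by rewrite eval_mxpolyE det_map_mx.
have divE t : eval_mxpoly t B \in unitmx ->
    eval_mxpoly t A *m invmx (eval_mxpoly t B) =
    ((\det B).[t]^-1)%:M *m eval_mxpoly t (A *m \adj B).
  move=> Btu; rewrite /invmx Btu detE -scalemxAr mul_scalar_mx; congr (_ *: _).
  by rewrite !eval_mxpolyE map_mxM map_mx_adj.
have D0 : (\det B).[t0] != 0 by rewrite -detE -unitfE -unitmxE.
rewrite divE //.
have [d1 d1_gt0 H1] := mulmx_close (((\det B).[t0]^-1)%:M)
  (eval_mxpoly t0 (A *m \adj B)) eps_gt0.
have [d2 d2_gt0 H2] := inv_close D0 d1_gt0.
have [d3 d3_gt0 H3] := horner_close (\det B) t0 d2_gt0.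
have [d4 d4_gt0 H4] := eval_mxpoly_close (A *m \adj B) t0 d1_gt0.
have [d d_gt0 [dd3 dd4]] := exists_le2 d3_gt0 d4_gt0; exists d => // t tt0 Btu.
rewrite divE //; apply: H1; last by apply: H4; apply: lt_le_trans dd4.
move=> i j; rewrite !mxE -mulrnBl; case: (i == j); rewrite ?mulr0n ?normr0 // mulr1n.
by apply/H2/H3; apply: lt_le_trans dd3.
Qed.

Lemma limit_eval_mxpoly n (Y : 'M[{poly C}]_n) (M : 'M[C]_n) :
  map_mx (horner^~ t) Y @[t --> (0 : C)^'] --> M -> eval_mxpoly 0 Y = M.
Proof.
move=> YM; apply/matrixP => i j; apply/eqP; rewrite -subr_eq0; apply: contraT => ne.
have e_gt0 : 0 < `|eval_mxpoly 0 Y i j - M i j| / 2 by rewrite divr_gt0 ?normr_gt0.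
have [d1 d1_gt0 H1] := eval_mxpoly_close Y 0 e_gt0.
have /cvg_ballP/(_ _ e_gt0) := YM.
case/nbhs_ballP => d2 /= d2_gt0 H2.
have [d d_gt0 [dd1 dd2]] := exists_le2 d1_gt0 d2_gt0.
have [t [_ tt0 t0]] := nonroot_near 0 (oner_neq0 {poly C}) d_gt0.
have h1 := H1 t (lt_le_trans tt0 dd1) i j.
have tb : ball (0 : C) d2 t by rewrite /ball /= distrC; exact: lt_le_trans dd2.
have h2 : `|M i j - eval_mxpoly t Y i j| < `|eval_mxpoly 0 Y i j - M i j| / 2.
  exact: ((H2 t tb t0).2 i j).
have := ltrD h2 h1; rewrite -splitr => /(le_lt_trans (ler_distD _ _ _)).
by rewrite distrC ltxx.
Qed.

(** Near the limit the family lies in a space congruent to [L], and congruence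
    of a pair [(X, V)] turns into similarity of the quotient [X V^-1]. *)
Lemma segre_symbols_degenerate m n (L L' : {vspace 'M[C]_n}) U' s' :
  degenerates m L L' -> U' \in L' -> U' \in unitmx -> segre_symbols L' U' s' ->
  exists V s, [/\ V \in L, V \in unitmx, segre_symbols L V s & segre_ge s s'].
Proof.
move=> [X [X' [bX bX' [P [Q [[lP _ _] [lQ _ _] [Y YE]]]]]]] U'L U'u [Z' Z'L [bs' jf' s'E]].
have [K [P' [Q' polyE]]] := degeneration_polynomial lP lQ (fun i => (YE i).1).
(* The lift to the degenerating family of the matrix [W] of [L'], through its
   coordinates in the limit basis. *)
pose comb (W : 'M[C]_n) : 'M[{poly C}]_n := \sum_i (coord X' i W)%:P *: Y i.
have comb0 W : W \in L' -> eval_mxpoly 0 (comb W) = W.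
  move=> WL; rewrite [RHS](coord_basis bX' WL) eval_mxpolyE raddf_sum; apply: eq_bigr => i _ /=.
  rewrite map_mxZ /= /horner_eval hornerC -tnth_nth; congr (_ *: _).
  exact: limit_eval_mxpoly (YE i).2.
have combL t W : t != 0 -> exists2 V, V \in L & eval_mxpoly t (comb W) =
    eval_mxpoly t P' *m V *m (eval_mxpoly t P')^T.
  move=> t0; pose V := \sum_i \sum_j (t ^- K * coord X' i W * (Q' j i).[t]) *: tnth X j.
  exists V.
    rewrite rpred_sum // => i _; rewrite rpred_sum // => j _; rewrite rpredZ //.
    by apply: (basis_mem bX); exact: mem_tnth.
  rewrite mulmx_sumr mulmx_suml !eval_mxpolyE raddf_sum.
  apply: eq_bigr => i _; rewrite /= map_mxZ /= {1}/horner_eval hornerC.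
  have := congr1 (map_mx (horner_eval t)) (polyE i).
  rewrite map_mxZ raddf_sum /= {1}/horner_eval hornerXn => YtE.
  apply: (can_inj (scalerK (expf_neq0 K t0))).
  rewrite scalerA mulrC -scalerA YtE scaler_sumr mulmx_sumr mulmx_suml scaler_sumr.
  apply: eq_bigr => j _; rewrite map_mxZ !map_mxM -map_trmx -map_mx_comp.
  rewrite (_ : map_mx _ (tnth X j) = tnth X j); last first.
    by apply/matrixP => a b; rewrite mxE /= /horner_eval hornerC.
  rewrite -scalemxAr -!scalemxAl !scalerA; congr (_ *: _).
  by rewrite /horner_eval !mulrA mulfV ?mul1r // expf_neq0.
have B0u : eval_mxpoly 0 (comb U') \in unitmx by rewrite comb0.
have [d d_gt0 H] := segre_semicontinuous jf'.
have [e e_gt0 He] := eval_mxpoly_div_close (comb Z') B0u d_gt0.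
have detE t : \det (eval_mxpoly t (comb U')) = (\det (comb U')).[t].
  by rewrite eval_mxpolyE det_map_mx.
have det0 : \det (comb U') != 0.
  apply: contraTneq B0u => D0.
  by rewrite unitmxE detE D0 horner0 unitr0.
have [t [Dt tt0 t0]] := nonroot_near 0 det0 e_gt0.
have Btu : eval_mxpoly t (comb U') \in unitmx by rewrite unitmxE detE unitfE.
have [V VL VE] := combL t U' t0; have [Z ZL ZE] := combL t Z' t0.
set Pt := eval_mxpoly t P' in VE ZE.
have /andP[/andP[Pu Vu] PTu] : (Pt \in unitmx) && (V \in unitmx) && (Pt^T \in unitmx).
  by move: Btu; rewrite VE !unitmx_mul.
have [bs jf] := jordan_form_exists (Z *m invmx V).
exists V, (segre_of_blocks bs); split=> //; first by exists Z => //; exists bs.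
rewrite s'E; apply: (H (eval_mxpoly t (comb Z') *m invmx (eval_mxpoly t (comb U')))).
  by have := He t tt0 Btu; rewrite !comb0.
apply: (jordan_form_conj (P := Pt) (P' := invmx Pt) _ _ _ jf).
- exact: mulmxV.
- exact: mulVmx.
apply: (can_inj (mulmxK Btu)); rewrite mulmxKV // VE ZE !mulmxA.
by rewrite mulmxKV // mulmxKV.
Qed.

End Degeneration.

Theorem proposition6p12 (R : realType) (m n : nat)
    (L L' : {vspace 'M[R[i]]_n})
    (jL : is_jordan_space L) (jL' : is_jordan_space L')
    (dL : \dim L = m) (dL' : \dim L' = m)
    (hdeg : degenerates m L L') :
  segre_ge (jordan_segre_symbol L) (jordan_segre_symbol L').
Proof.
have [U [UL Uu Umax]] := jordan_segre_symbolP jL.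
have [U' [U'L U'u [U'sym _]]] := jordan_segre_symbolP jL'.
have [V [s [VL Vu Vs ge_s]]] := segre_symbols_degenerate hdeg U'L U'u U'sym.
have [_ [W [WL Wu Wj]]] := jL.
have Us : segre_symbols L U s.
  apply/(segre_symbols_unit WL Wu Wj UL Uu).
  exact/(segre_symbols_unit WL Wu Wj VL Vu).
exact: segre_ge_trans (segre_maximal_greatest Umax Us) ge_s.
Qed.
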